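(* For $i=1,2$ let $d_i\in\mathbb Z_{>0}$ and let $I_i$ be a non-zero ideal of $R^+_{d_i}=\mathbb Z[u_1,\dots,u_{d_i}]$. Assume for $i=1,2$: (a) $V(I_i)$ is finite and $u_k\notin I_i$ for $k=1,\dots,d_i$; (b) $z_k\neq0$ for every $\mathbf z=(z_1,\dots,z_{d_i})\in V(I_i)$ and every $k$; (c) there is a monomial $f$ in $u_1,\dots,u_{d_i}$ with $f(\mathbf z)\neq1$ for all $\mathbf z\in V(I_i)$; (d) for each $1\le j\le d_i$ there is a rational prime $p$ with $p\mid N(\dot u_j)$ and $p\nmid N(\dot u_k)$ for all $k\ne j$. Then the following are equivalent: (i) the algebraic actions $\mathbb N^{d_1}\curvearrowright R^+_{d_1}/I_1$ and $\mathbb N^{d_2}\curvearrowright R^+_{d_2}/I_2$ are isomorphic; (ii) the groupoids $(R_{d_1}/I_1R_{d_1}\rtimes\mathbb Z^{d_1})\ltimes\Omega_{I_1}$ and $(R_{d_2}/I_2R_{d_2}\rtimes\mathbb Z^{d_2})\ltimes\Omega_{I_2}$ are isomorphic as topological groupoids.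
   Context: $V(I)=\{\mathbf z\in\mathbb C^d:f(\mathbf z)=0\ \forall f\in I\}$. Under (a), $R^+_d/I$ is a commutative ring whose additive group is finitely generated and torsion-free. $\dot u_j$ is the image of $u_j$ in $R^+_d/I$; for a ring $R$ of this kind and $a\in R$, $N(a)=|\det(x\mapsto ax)|$ on $\mathbb Q\otimes R$. The action $\mathbb N^d\curvearrowright R^+_d/I$ sends $n=(n_1,\dots,n_d)$ to multiplication by $\dot u_1^{n_1}\cdots\dot u_d^{n_d}$ (injective endomorphisms under (b)). $R_d=\mathbb Z[u_1^{\pm1},\dots,u_d^{\pm1}]$; $R^+_d/I$ embeds in $R_d/IR_d$, on which $\mathbb Z^d$ acts by multiplication by $\dot u^n$ (a globalization). $\Omega_I=\varprojlim_C(R^+_d/I)/C$ over the constructible subgroups $C$ of $\mathbb N^d\curvearrowright R^+_d/I$ (smallest family containing $R^+_d/I$ closed under $C\mapsto\dot u^nC$ and $C\mapsto\{x:\dot u^nx\in C\}$). $(R_d/IR_d)\rtimes\mathbb Z^d$ acts on $R_d/IR_d$ by affine maps; the restriction to $R^+_d/I$ is a partial action extending uniquely to a partial action on $\Omega_I$ by homeomorphisms between open sets, whose partial transformation groupoid is the groupoid in (ii). Isomorphism of algebraic actions: monoid isomorphism $\mathfrak t$ of the acting monoids and group isomorphism $\mathfrak b$ with $\mathfrak b(\sigma_s x)=\tau_{\mathfrak t(s)}\mathfrak b(x)$. *)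

(* Defs.v *)
From HB Require Import structures.
From mathcomp Require Import all_boot all_order all_algebra.
From mathcomp Require Import Rstruct.
From mathcomp Require Import complex.
From mathcomp Require Import mpoly.
From Stdlib Require Import ClassicalEpsilon List.

Set Implicit Arguments.
Unset Strict Implicit.
Unset Printing Implicit Defensive.

Import GRing.Theory.
Local Open Scope ring_scope.

Definition CC : numClosedFieldType := (Rdefinitions.R)[i].

Definition Pol (d : nat) := {mpoly int[d]}.

(* Monomial u^n for n in N^d (N^d is represented by multinomials 'X_{1..d}). *)
Definition mono (d : nat) (n : 'X_{1..d}) : Pol d := 'X_[n].

Definition is_ideal (d : nat) (I : Pol d -> Prop) : Prop :=
  [/\ I 0, (forall x y, I x -> I y -> I (x + y)) & (forall a x, I x -> I (a * x))].

Definition nonzero_ideal (d : nat) (I : Pol d -> Prop) : Prop :=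
  exists f, I f /\ f <> 0.

Definition cong (d : nat) (I : Pol d -> Prop) (x y : Pol d) : Prop := I (x - y).

Definition ev (d : nat) (f : Pol d) (z : 'I_d -> CC) : CC :=
  (map_mpoly (fun k : int => (k%:~R : CC)) f).@[z].

Definition inV (d : nat) (I : Pol d -> Prop) (z : 'I_d -> CC) : Prop :=
  forall f, I f -> ev f z = 0.

Definition cond_a (d : nat) (I : Pol d -> Prop) : Prop :=
  (exists s : list ('I_d -> CC), forall z, inV I z -> List.In z s) /\
  (forall k : 'I_d, ~ I ('X_k)).

Definition cond_b (d : nat) (I : Pol d -> Prop) : Prop :=
  forall z, inV I z -> forall k : 'I_d, z k <> 0.

Definition cond_c (d : nat) (I : Pol d -> Prop) : Prop :=
  exists n : 'X_{1..d}, forall z, inV I z -> ev (mono n) z <> 1.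

Definition is_Zbasis (d : nat) (I : Pol d -> Prop) (r : nat) (b : 'I_r -> Pol d) :=
  (forall x, exists c : 'I_r -> int, cong I x (\sum_(i < r) c i *: b i)) /\
  (forall c : 'I_r -> int, cong I (\sum_(i < r) c i *: b i) 0 -> forall i, c i = 0).

(* norm_is I a n  <->  N(a) = n, where N(a) = |det(x |-> a x)| on Q (x) R^+_d/I,
   computed as |det| of the integer matrix of multiplication by a in a Z-basis. *)
Definition norm_is (d : nat) (I : Pol d -> Prop) (a : Pol d) (n : nat) : Prop :=
  exists (r : nat) (b : 'I_r -> Pol d) (M : 'M[int]_r),
    [/\ is_Zbasis I b,
        (forall i, cong I (a * b i) (\sum_(j < r) M i j *: b j)) &
        `|\det M|%N = n].

Definition cond_d (d : nat) (I : Pol d -> Prop) : Prop :=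
  forall j : 'I_d, exists p : nat,
    [/\ prime p,
        (exists n, norm_is I ('X_j) n /\ (p %| n)%N) &
        (forall k : 'I_d, k <> j -> forall n, norm_is I ('X_k) n -> ~~ (p %| n)%N)].

(* t : N^d1 -> N^d2 monoid isomorphism; b induces (via representatives) a
   group isomorphism R^+_d1/I1 -> R^+_d2/I2 intertwining the actions. *)
Definition alg_act_iso (d1 d2 : nat) (I1 : Pol d1 -> Prop) (I2 : Pol d2 -> Prop) : Prop :=
  exists (t : 'X_{1..d1} -> 'X_{1..d2}) (b : Pol d1 -> Pol d2),
    [/\ bijective t,
        (forall m n, t (m + n)%MM = (t m + t n)%MM) &
      [/\ (forall x y, cong I1 x y <-> cong I2 (b x) (b y)),
        (forall y, exists x, cong I2 (b x) y),
        (forall x y, cong I2 (b (x + y)) (b x + b y)) &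
        (forall n x, cong I2 (b (mono n * x)) (mono (t n) * b x))]].

(* A pair (m, p) represents u^{-m} p. *)
Definition LRep (d : nat) := ('X_{1..d} * Pol d)%type.

Definition lequiv (d : nat) (I : Pol d -> Prop) (r s : LRep d) : Prop :=
  exists k : 'X_{1..d}, I (mono k * (mono s.1 * r.2 - mono r.1 * s.2)).

(* elements of R_d / I R_d as equivalence classes *)
Definition LCl (d : nat) (I : Pol d -> Prop) :=
  {S : LRep d -> Prop | exists r, S = lequiv I r}.

Definition lclass (d : nat) (I : Pol d -> Prop) (r : LRep d) : LCl I :=
  exist _ (lequiv I r) (ex_intro _ r erefl).

Definition lrep (d : nat) (I : Pol d -> Prop) (v : LCl I) : LRep d :=
  proj1_sig (constructive_indefinite_description _ (proj2_sig v)).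

Definition ladd (d : nat) (I : Pol d -> Prop) (v w : LCl I) : LCl I :=
  let r := lrep v in let s := lrep w in
  lclass I ((r.1 + s.1)%MM, mono s.1 * r.2 + mono r.1 * s.2).

Definition lopp (d : nat) (I : Pol d -> Prop) (v : LCl I) : LCl I :=
  let r := lrep v in lclass I (r.1, - r.2).

Definition zpos (d : nat) (n : 'I_d -> int) : 'X_{1..d} :=
  [multinom (if n i is Posz k then k else 0%N) | i < d].
Definition zneg (d : nat) (n : 'I_d -> int) : 'X_{1..d} :=
  [multinom (if n i is Negz k then k.+1 else 0%N) | i < d].

Definition lmono (d : nat) (I : Pol d -> Prop) (n : 'I_d -> int) (v : LCl I) : LCl I :=
  let r := lrep v in lclass I ((r.1 + zneg n)%MM, mono (zpos n) * r.2).

Definition emb (d : nat) (I : Pol d -> Prop) (x : Pol d) : LCl I := lclass I (0%MM, x).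

Definition Grp (d : nat) (I : Pol d -> Prop) := (LCl I * ('I_d -> int))%type.

Definition gmul (d : nat) (I : Pol d -> Prop) (g h : Grp I) : Grp I :=
  (ladd g.1 (lmono g.2 h.1), fun i => g.2 i + h.2 i).
Definition ginv (d : nat) (I : Pol d -> Prop) (g : Grp I) : Grp I :=
  (lopp (lmono (fun i => - g.2 i) g.1), fun i => - g.2 i).
Definition gone (d : nat) (I : Pol d -> Prop) : Grp I :=
  (lclass I (0%MM, 0), fun _ => 0).
Definition gact (d : nat) (I : Pol d -> Prop) (g : Grp I) (v : LCl I) : LCl I :=
  ladd g.1 (lmono g.2 v).

(* subgroups of R^+_d/I are represented by their preimages in R^+_d *)
Inductive constructible (d : nat) (I : Pol d -> Prop) : (Pol d -> Prop) -> Prop :=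
| cons_top : constructible I (fun _ => True)
| cons_img (n : 'X_{1..d}) (C : Pol d -> Prop) :
    constructible I C ->
    constructible I (fun x => exists c, C c /\ cong I x (mono n * c))
| cons_pre (n : 'X_{1..d}) (C : Pol d -> Prop) :
    constructible I C -> constructible I (fun x => C (mono n * x)).

(* a point of the inverse limit: a compatible choice of a coset of each
   constructible C (cosets represented as subsets of R^+_d) *)
Definition is_Om_point (d : nat) (I : Pol d -> Prop)
    (w : (Pol d -> Prop) -> Pol d -> Prop) : Prop :=
  [/\ (forall C, constructible I C -> exists x, forall y, w C y <-> C (y - x)),
      (forall C D, constructible I C -> constructible I D ->
          (forall y, C y -> D y) -> forall y, w C y -> w D y) &
      (forall C, ~ constructible I C -> forall y, ~ w C y)].

Definition Om (d : nat) (I : Pol d -> Prop) := {w | is_Om_point I w}.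

Lemma iota_proof (d : nat) (I : Pol d -> Prop) (x : Pol d) :
  is_Om_point I (fun C y => constructible I C /\ C (y - x)).
Proof.
split.
- by move=> C HC; exists x => y; split => [[]|].
- by move=> C D _ HD HCD y [_ Hy]; split => //; apply: HCD.
- by move=> C HC y [].
Qed.

Definition iota (d : nat) (I : Pol d -> Prop) (x : Pol d) : Om I :=
  exist _ _ (iota_proof I x).

(* topology of Omega_I: product of discrete topologies *)
Definition agree (d : nat) (I : Pol d -> Prop) (Cs : list (Pol d -> Prop)) (w w' : Om I) :=
  forall C, List.In C Cs -> forall y, proj1_sig w C y <-> proj1_sig w' C y.

Definition open_Om (d : nat) (I : Pol d -> Prop) (U : Om I -> Prop) : Prop :=
  forall w, U w -> exists Cs, forall w', agree Cs w w' -> U w'.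

Definition closure_Om (d : nat) (I : Pol d -> Prop) (S : Om I -> Prop) (w : Om I) : Prop :=
  forall Cs, exists w', S w' /\ agree Cs w w'.

Definition cont_on (d : nat) (I : Pol d -> Prop) (D : Om I -> Prop) (f : Om I -> Om I) :=
  forall w, D w -> forall Cs, exists Cs', forall w', D w' -> agree Cs' w w' ->
    agree Cs (f w) (f w').

(* (Dom g, th g): the extension to Omega_I of the partial action of
   (R_d/IR_d) x| Z^d on R^+_d/I; th g is defined on Dom g = D_{g^{-1}}. *)
Definition is_Om_ext (d : nat) (I : Pol d -> Prop)
    (Dom : Grp I -> Om I -> Prop) (th : Grp I -> Om I -> Om I) : Prop :=
  [/\
      (forall g w, Dom g w <->
         closure_Om (fun w' => exists x y, w' = iota I x /\ gact g (emb I x) = emb I y) w),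
      (forall g x y, gact g (emb I x) = emb I y -> th g (iota I x) = iota I y) &
    [/\ (forall w, th (gone I) w = w),
      (forall g w, Dom g w -> Dom (ginv g) (th g w) /\ th (ginv g) (th g w) = w),
      (forall g h w, Dom h w -> Dom g (th h w) ->
          Dom (gmul g h) w /\ th (gmul g h) w = th g (th h w)) &
      (forall g, open_Om (Dom g) /\ cont_on (Dom g) (th g))]].

Definition arrow (d : nat) (I : Pol d -> Prop) (Dom : Grp I -> Om I -> Prop)
    (a : Grp I * Om I) : Prop := Dom a.1 a.2.

Definition gpd_morph (d1 d2 : nat) (I1 : Pol d1 -> Prop) (I2 : Pol d2 -> Prop)
    (Dom1 : Grp I1 -> Om I1 -> Prop) (th1 : Grp I1 -> Om I1 -> Om I1)
    (Dom2 : Grp I2 -> Om I2 -> Prop) (th2 : Grp I2 -> Om I2 -> Om I2)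
    (phi : Grp I1 * Om I1 -> Grp I2 * Om I2) : Prop :=
  [/\ (forall a, arrow Dom1 a -> arrow Dom2 (phi a)),
      (* composable pairs (h, th g w), (g, w) with product (hg, w) *)
      (forall g h w, Dom1 g w -> Dom1 h (th1 g w) ->
         (phi (h, th1 g w)).2 = th2 (phi (g, w)).1 (phi (g, w)).2 /\
         phi (gmul h g, w) = (gmul (phi (h, th1 g w)).1 (phi (g, w)).1, (phi (g, w)).2)) &
      (* continuity (group discrete, product topology) *)
      (forall g w, Dom1 g w -> forall Cs, exists Cs', forall w', Dom1 g w' ->
         agree Cs' w w' ->
         (phi (g, w')).1 = (phi (g, w)).1 /\ agree Cs (phi (g, w)).2 (phi (g, w')).2)].

Definition gpd_iso (d1 d2 : nat) (I1 : Pol d1 -> Prop) (I2 : Pol d2 -> Prop)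
    (Dom1 : Grp I1 -> Om I1 -> Prop) (th1 : Grp I1 -> Om I1 -> Om I1)
    (Dom2 : Grp I2 -> Om I2 -> Prop) (th2 : Grp I2 -> Om I2 -> Om I2) : Prop :=
  exists (phi : Grp I1 * Om I1 -> Grp I2 * Om I2) (psi : Grp I2 * Om I2 -> Grp I1 * Om I1),
    [/\ gpd_morph Dom1 th1 Dom2 th2 phi, gpd_morph Dom2 th2 Dom1 th1 psi,
        (forall a, arrow Dom1 a -> psi (phi a) = a) &
        (forall b, arrow Dom2 b -> phi (psi b) = b)].

(* Main.v *)
Require Import Defs.
From HB Require Import structures.
From mathcomp Require Import all_boot all_order all_algebra.
From mathcomp Require Import mpoly.
From mathcomp Require Import zify ring.
From Stdlib Require Import ClassicalEpsilon FunctionalExtensionality.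
From Stdlib Require Import PropExtensionality ProofIrrelevance.

(** Write R = R^+_d/I, u = u_1 ... u_d and L = R_d/IR_d. Every constructible
    subgroup contains some u^N R, so Omega_I is the u-adic completion of R and
    each R/u^N R is finite.

    From groupoids to actions. A groupoid isomorphism is a homeomorphism
    Omega_1 -> Omega_2 together with a cocycle with values in L_2 x| Z^d2. On the
    translations by R_1 the cocycle is locally constant, hence by compactness and
    finite generation it depends only on the point modulo a fixed u^N; it is
    therefore a homomorphism rho on u^N R_1. A non-zero Z^d2-component of rho(b)
    would have to be almost isometric on small scales, for multiples kb close to
    0, which the primes of condition (d) forbid. So rho takes values in the
    translations by R_2. The cocycle of a suitable affine map (s, n) conjugates
    rho(b) into rho(u^n b), so that rho(u^n b) = u^t(n) rho(b) for b small. Since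
    rho hits a power of u, condition (d) makes t(n) unique and non-negative, and
    the inverse groupoid isomorphism inverts t. Hence u^n |-> u^t(n) is a ring
    isomorphism between the polynomial rings, and since rho is injective it
    carries I_1 onto I_2.

    From actions to groupoids. An isomorphism of actions matches constructible
    subgroups and extends to L and to Omega_I; density of R in Omega_I and
    continuity transport the partial action. *)

Set Implicit Arguments.
Unset Strict Implicit.
Unset Printing Implicit Defensive.

Import Order.TTheory GRing.Theory Num.Theory.
Local Open Scope ring_scope.

(** * Congruences modulo an ideal of the polynomial ring *)

Section Ideals.

Variables (d : nat) (I : Pol d -> Prop).
Hypothesis idI : is_ideal I.

Lemma ideal0 : I 0. Proof. by case: idI. Qed.

Lemma idealD x y : I x -> I y -> I (x + y).
Proof. by case: idI => _ + _; apply. Qed.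

Lemma idealM a x : I x -> I (a * x).
Proof. by case: idI => _ _; apply. Qed.

Lemma idealN x : I x -> I (- x).
Proof. by move=> Ix; rewrite -mulN1r; apply: idealM. Qed.

Lemma idealB x y : I x -> I y -> I (x - y).
Proof. by move=> Ix Iy; apply: idealD => //; apply: idealN. Qed.

Lemma ideal_eq x y : x = y -> I x -> I y. Proof. by move=> ->. Qed.

Lemma ideal_sum (J : finType) (F : J -> Pol d) :
  (forall j, I (F j)) -> I (\sum_j F j).
Proof.
by move=> IF; apply: (big_ind I) => //; [exact: ideal0 | exact: idealD].
Qed.

Lemma idealZ (c : int) x : I x -> I (c *: x).
Proof. by move=> Ix; rewrite -mul_mpolyC; apply: idealM. Qed.

Lemma cong_eq x y x' y' : x - y = x' - y' -> cong I x y -> cong I x' y'.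
Proof. by rewrite /cong => ->. Qed.

Lemma cong_refl x : cong I x x.
Proof. by rewrite /cong subrr; exact: ideal0. Qed.

Lemma cong_sym x y : cong I x y -> cong I y x.
Proof. by move=> /idealN; rewrite /cong opprB. Qed.

Lemma cong_trans y x z : cong I x y -> cong I y z -> cong I x z.
Proof. by move=> xy yz; have := idealD xy yz; rewrite addrA subrK. Qed.

Lemma congD x y x' y' : cong I x y -> cong I x' y' -> cong I (x + x') (y + y').
Proof. by move=> h h'; apply: ideal_eq (idealD h h'); ring. Qed.

Lemma congM a x y : cong I x y -> cong I (a * x) (a * y).
Proof. by move=> h; apply: ideal_eq (idealM a h); ring. Qed.

Lemma congN x y : cong I x y -> cong I (- x) (- y).
Proof. by move=> h; apply: ideal_eq (idealN h); ring. Qed.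

Lemma cong0 x : cong I x 0 <-> I x.
Proof. by rewrite /cong subr0. Qed.

Lemma cong_ideal x y : cong I x y -> I x -> I y.
Proof. by move=> h Ix; apply: ideal_eq (idealB Ix h); ring. Qed.

End Ideals.

Lemma monoD d (m n : 'X_{1..d}) : mono (m + n)%MM = mono m * mono n.
Proof. exact: mpolyXD. Qed.

Lemma mono0 d : mono (0%MM : 'X_{1..d}) = 1.
Proof. exact: mpolyX0. Qed.

(** The condition under which R embeds in L, as [emb_inj] shows. *)
Definition u_regular d (I : Pol d -> Prop) :=
  forall (n : 'X_{1..d}) x, I (mono n * x) -> I x.

(** The u_j-adic valuation of a monomial survives in R. In this form the primes of condition (d)
    enter every later comparison of exponents. *)
Definition var_independent d (I : Pol d -> Prop) :=
  forall (j : 'I_d) k (A : 'X_{1..d}) z,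
    cong I (mono A) ('X_j ^+ k * z) -> (k <= A j)%N.

(** * Norms and condition (d) *)

Section ZBasis.

Variables (d : nat) (I : Pol d -> Prop) (r : nat) (b : 'I_r -> Pol d).
Hypotheses (idI : is_ideal I) (bb : is_Zbasis I b).

Definition lincomb (c : 'rV[int]_r) : Pol d := \sum_(i < r) c 0 i *: b i.

Lemma lincombD c c' : lincomb (c + c') = lincomb c + lincomb c'.
Proof.
by rewrite -big_split; apply: eq_bigr => i _; rewrite mxE scalerDl.
Qed.

Lemma lincombZ a c : lincomb (a *: c) = a *: lincomb c.
Proof.
by rewrite scaler_sumr; apply: eq_bigr => i _; rewrite mxE scalerA.
Qed.

Lemma lincombN c : lincomb (- c) = - lincomb c.
Proof. by rewrite -scaleN1r lincombZ scaleN1r. Qed.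

Lemma lincomb_inj c c' : cong I (lincomb c) (lincomb c') -> c = c'.
Proof.
case: bb => _ uniq_b; rewrite /cong -lincombN -lincombD => Icc.
apply/eqP; rewrite -subr_eq0; apply/eqP/rowP => i.
rewrite [RHS]mxE; apply: (uniq_b (fun i => (c - c') 0 i)).
exact/(cong0 I).
Qed.

Lemma zcoord_sig x : {c : 'rV[int]_r | cong I x (lincomb c)}.
Proof.
apply: constructive_indefinite_description.
have [c xc] := bb.1 x; exists (\row_i c i).
by rewrite /lincomb; under eq_bigr do rewrite mxE.
Qed.

Definition zcoord x := sval (zcoord_sig x).

Lemma zcoordP x : cong I x (lincomb (zcoord x)).
Proof. exact: (svalP (zcoord_sig x)). Qed.

Lemma zcoord_uniq x c : cong I x (lincomb c) -> zcoord x = c.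
Proof.
move=> xc; apply: lincomb_inj; apply: (cong_trans idI) xc.
by apply: (cong_sym idI); apply: zcoordP.
Qed.

Definition mulmat a : 'M[int]_r := \matrix_i zcoord (a * b i).

Lemma lincomb_mulmat a c : cong I (a * lincomb c) (lincomb (c *m mulmat a)).
Proof.
have -> : lincomb (c *m mulmat a)
  = \sum_(i < r) c 0 i *: lincomb (zcoord (a * b i)).
  rewrite /lincomb; under [RHS]eq_bigr do rewrite scaler_sumr.
  rewrite exchange_big; apply: eq_bigr => j _ /=.
  rewrite mxE scaler_suml; apply: eq_bigr => i _.
  by rewrite scalerA mxE.
rewrite /cong mulr_sumr -sumrB; apply: (ideal_sum idI) => i.
rewrite -scalerAr -scalerBr; apply: (idealZ idI); exact: zcoordP.
Qed.

Lemma zcoordM a x : zcoord (a * x) = zcoord x *m mulmat a.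
Proof.
apply: zcoord_uniq; apply: (cong_trans idI) (lincomb_mulmat a (zcoord x)).
by apply: (congM idI); apply: zcoordP.
Qed.

(** Coordinates are unique, so the matrix in a witness of [norm_is] can only be [mulmat]. *)
Lemma mulmatP a (M : 'M[int]_r) :
  (forall i, cong I (a * b i) (\sum_(j < r) M i j *: b j)) -> M = mulmat a.
Proof.
move=> aM; apply/row_matrixP => i; rewrite rowK; apply/esym/zcoord_uniq.
by rewrite /lincomb; under eq_bigr do rewrite mxE; apply: aM.
Qed.

Lemma norm_is_mulmat a : norm_is I a `|\det (mulmat a)|%N.
Proof.
exists r, b, (mulmat a); split=> // i; have := zcoordP (a * b i).
by rewrite /lincomb; under [X in _ -> cong _ _ X]eq_bigr do rewrite mxE.
Qed.

(** The order is reversed because coordinates are row vectors, on which matrices act from the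
    right. *)
Lemma mulmatM a a' : mulmat (a * a') = mulmat a' *m mulmat a.
Proof.
apply/row_matrixP => i.
by rewrite row_mul !rowK -mulrA zcoordM.
Qed.

Lemma mulmat1 : mulmat 1 = 1%:M.
Proof.
apply/row_matrixP => i; rewrite rowK; apply: zcoord_uniq.
rewrite mul1r /lincomb (bigD1 i) //= !mxE !eqxx scale1r big1 ?addr0.
  exact: (cong_refl idI).
by move=> j ji; rewrite !mxE eq_sym (negPf ji) scale0r.
Qed.

Lemma mulmat_cong a a' : cong I a a' -> mulmat a = mulmat a'.
Proof.
move=> aa; apply/row_matrixP => i; rewrite !rowK; apply: zcoord_uniq.
apply: (cong_trans idI) (zcoordP _); rewrite mulrC (mulrC a').
exact: (congM idI).
Qed.

Definition nrm a := `|\det (mulmat a)|%N.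

Lemma nrmM a a' : nrm (a * a') = (nrm a * nrm a')%N.
Proof. by rewrite /nrm mulmatM det_mulmx abszM mulnC. Qed.

Lemma nrm1 : nrm 1 = 1%N.
Proof. by rewrite /nrm mulmat1 det1. Qed.

Lemma nrmX a k : nrm (a ^+ k) = (nrm a ^ k)%N.
Proof.
by elim: k => [|k IH]; rewrite ?expr0 ?nrm1 // exprS nrmM IH expnS.
Qed.

Lemma nrm_mono (A : 'X_{1..d}) : nrm (mono A) = (\prod_i nrm ('X_i) ^ A i)%N.
Proof.
rewrite /mono mpolyXE_id (big_morph nrm nrmM nrm1).
by apply: eq_bigr => i _; rewrite nrmX.
Qed.

Lemma nrm_regular a x : nrm a <> 0%N -> I (a * x) -> I x.
Proof.
move=> na Iax; have : zcoord x *m mulmat a = 0.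
  rewrite -zcoordM; apply: zcoord_uniq; rewrite -(scale0r 0) lincombZ scale0r.
  exact/(cong0 I).
case: (eqVneq (zcoord x) 0) => [x0 _|nx xa].
  have := zcoordP x; rewrite x0 -(scale0r 0) lincombZ scale0r.
  by move/(cong0 I).
have /eqP : \det (mulmat a) == 0 by apply/det0P; exists (zcoord x).
by rewrite /nrm in na => d0; rewrite d0 in na.
Qed.

(** Cramer's rule: the adjugate inverts the matrix of a up to its determinant, and the sign turns
    the determinant into N(a). So N(a)R lies in aR, which bounds R/aR once N(a) is non-zero. *)
Lemma nrm_dvd a x : exists c, cong I ((nrm a)%:R * x) (a * c).
Proof.
exists (lincomb (Num.sg (\det (mulmat a)) *: (zcoord x *m \adj (mulmat a)))).
apply: (cong_sym idI); apply: (cong_trans idI) (lincomb_mulmat _ _) _.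
rewrite -scalemxAl -mulmxA mul_adj_mx mul_mx_scalar scalerA.
rewrite -normrEsg lincombZ.
rewrite -[(nrm a)%:R]/((nrm a)%:R : {mpoly int[d]}) mulr_natl -scaler_nat.
rewrite /nrm natz abszE; apply: (cong_sym idI).
by rewrite /cong -scalerBr; apply: (idealZ idI); apply: zcoordP.
Qed.

Lemma lincomb_torsion_free (c : 'rV[int]_r) x :
  c <> 0 -> cong I x (lincomb c) -> forall a : int, I (a *: x) -> a = 0.
Proof.
move=> nc xc a Iax; have : a *: c = 0.
  apply: lincomb_inj; rewrite -[in X in cong _ _ X](scale0r 0) !lincombZ scale0r.
  apply/(cong0 I); apply: (cong_ideal idI) Iax.
  by rewrite /cong -scalerBr; apply: (idealZ idI).
by move/eqP; rewrite scalemx_eq0 => /orP [/eqP //|/eqP].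
Qed.

End ZBasis.

Lemma logn_prod (J : finType) p (F : J -> nat) :
  (forall j, 0 < F j)%N -> logn p (\prod_j F j) = (\sum_j logn p (F j))%N.
Proof.
(* Positivity is carried through the induction because [lognM] requires it. *)
move=> F0; suff [] : (0 < \prod_j F j)%N /\
    logn p (\prod_j F j) = (\sum_j logn p (F j))%N by [].
apply: (big_ind2 (fun x y => (0 < x)%N /\ logn p x = y)) => //.
- by rewrite logn1.
- by move=> x1 x2 y1 y2 [x0 <-] [y0 <-]; rewrite muln_gt0 x0 y0 lognM.
Qed.

Lemma meval_intr0 (S : comNzRingType) d (f : {mpoly int[d]}) :
  (map_mpoly (fun k : int => k%:~R : S) f).@[fun=> 0] = (f@_0%MM)%:~R.
Proof.
elim/mpolyind: f => [|a m f _ _ IH]; first by rewrite raddf0 mcoeff0 meval0.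
rewrite raddfD /= mevalD IH map_mpolyZ mevalZ map_mpolyX mevalX.
rewrite mcoeffD mcoeffZ mcoeffX rmorphD rmorphM /=; congr (_ * _ + _).
have [->|m0] := eqVneq m 0%MM.
  by rewrite big1 // => i _; rewrite mnm0E expr0.
have /existsP [k mk] : [exists k, m k != 0%N].
  rewrite -negb_forall; apply: contra m0 => /forallP m0.
  by apply/eqP/mnmP => i; rewrite mnm0E; apply/eqP.
by rewrite (bigD1 k) //= expr0n (negPf mk) mul0r.
Qed.

Section Conditions.

Variables (d : nat) (I : Pol d -> Prop).
Hypotheses (idI : is_ideal I) (d_gt0 : (0 < d)%N).
Hypotheses (condb : cond_b I) (condd : cond_d I).

Lemma exists_Zbasis : exists (r : nat) (b : 'I_r -> Pol d), is_Zbasis I b.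
Proof.
by have [p [_ [n [[r [b [M [bb _ _]]]] _]] _]] := condd (Ordinal d_gt0);
   exists r, b.
Qed.

(* With a single variable u, a vector x killed by u has f x = f(0) x for every
   f, so 0 would lie in V(I). With several variables, condition (d) for
   another index already forces the norm to be non-zero. *)
Lemma nrm_var_neq0 r (b : 'I_r -> Pol d) (bb : is_Zbasis I b) (k : 'I_d) :
  nrm bb 'X_k <> 0%N.
Proof.
move=> nk; case: (pickP (fun j : 'I_d => j != k)) => [j jk|only_k].
  have [p [_ _ /(_ k)]] := condd j.
  have kj : k <> j by move=> kj; rewrite kj eqxx in jk.
  move=> /(_ kj _ (norm_is_mulmat bb 'X_k)).
  by rewrite -[`|_|%N]/(nrm bb 'X_k) nk dvdn0.
have /det0P [c nc ck] : \det (mulmat bb 'X_k) == 0 by rewrite -absz_eq0; apply/eqP.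
have Ikc : I ('X_k * lincomb b c).
  apply/(cong0 I); apply: (cong_trans idI) (lincomb_mulmat idI bb _ _) _.
  by rewrite ck -(scale0r 0) lincombZ scale0r; apply: (cong_refl idI).
have fc f : cong I (f * lincomb b c) (f@_0%MM *: lincomb b c).
  elim/mpolyind: f => [|a m f _ _ IH].
    by rewrite mul0r mcoeff0 scale0r; apply: (cong_refl idI).
  rewrite mulrDl mcoeffD mcoeffZ mcoeffX scalerDl; apply: (congD idI) IH.
  have [->|m0] := eqVneq m 0%MM.
    by rewrite mpolyX0 mulr1 -scalerAl mul1r; apply: (cong_refl idI).
  rewrite mulr0 scale0r; apply/(cong0 I); rewrite -scalerAl; apply: (idealZ idI).
  have mk : (m k != 0)%N.
    apply: contra m0 => /eqP mk; apply/eqP/mnmP => i; rewrite mnm0E.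
    by have := only_k i; move/negbFE/eqP => ->.
  have -> : m = ((m - U_(k)) + U_(k))%MM.
    apply/mnmP => i; rewrite mnmDE mnmBE mnm1E.
    have := only_k i; move/negbFE/eqP => ->.
    by rewrite eqxx subnK // lt0n.
  by rewrite mpolyXD -mulrA; apply: (idealM idI).
have V0 : inV I (fun=> 0).
  move=> f If; have f0 : f@_0%MM = 0.
    apply: (lincomb_torsion_free idI bb (elimN eqP nc) (cong_refl idI _)).
    by apply: (cong_ideal idI (fc f)); rewrite mulrC; apply: (idealM idI).
  by rewrite /ev meval_intr0 f0.
exact: (condb V0 (k := k)).
Qed.

Lemma nrm_mono_neq0 r (b : 'I_r -> Pol d) (bb : is_Zbasis I b) A :
  nrm bb (mono A) <> 0%N.
Proof.
apply/eqP; rewrite nrm_mono // -lt0n prodn_gt0 // => i.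
by rewrite expn_gt0 lt0n; apply/orP; left; apply/eqP; exact: nrm_var_neq0.
Qed.

Lemma cond_u_regular : u_regular I.
Proof.
move=> n x; have [r [b bb]] := exists_Zbasis.
by apply: (nrm_regular idI (bb := bb)); apply: nrm_mono_neq0.
Qed.

(** The quotient by u^A R is killed by k = N(u^A). Besides finiteness of quotients this gives, for
    every b, a positive multiple kb as close to 0 as desired. *)
Lemma mono_finite_index A :
  exists2 k, (0 < k)%N & forall x, exists c, cong I (k%:R * x) (mono A * c).
Proof.
have [r [b bb]] := exists_Zbasis.
exists (nrm bb (mono A)); last by move=> x; apply: nrm_dvd.
by rewrite lt0n; apply/eqP; apply: nrm_mono_neq0.
Qed.

(* Compare p-adic valuations of norms for the prime p of condition (d). *)
Lemma cond_var_independent : var_independent I.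
Proof.
move=> j k A z /=.
have [p [pp [n [[r [b [M [bb jM]]]]]]]] := condd j.
rewrite (mulmatP idI bb jM) -[`|_|%N]/(nrm bb 'X_j) => <- pj pn Ajz.
have nv i : (0 < nrm bb 'X_i)%N by rewrite lt0n; apply/eqP; exact: nrm_var_neq0.
have lj : (0 < logn p (nrm bb 'X_j))%N by rewrite logn_gt0 mem_primes pp nv.
have lk i : i != j -> logn p (nrm bb 'X_i) = 0%N.
  move=> ij; apply: contraNeq (pn i (elimN eqP ij) _ (norm_is_mulmat bb 'X_i)).
  by rewrite -lt0n logn_gt0 mem_primes => /and3P [].
have : nrm bb (mono A) = (nrm bb 'X_j ^ k * nrm bb z)%N.
  by rewrite /nrm (mulmat_cong idI bb Ajz) -!/(nrm bb _) nrmM // nrmX.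
move=> e; have : logn p (nrm bb (mono A)) = (A j * logn p (nrm bb 'X_j))%N.
  rewrite nrm_mono // logn_prod; last by move=> i; rewrite expn_gt0 nv.
  rewrite (bigD1 j) //= lognX big1 ?addn0 // => i ij.
  by rewrite lognX lk // muln0.
have z0 : (0 < nrm bb z)%N.
  by have := @nrm_mono_neq0 _ _ bb A; rewrite e; case: (nrm bb z); rewrite ?muln0.
rewrite e lognM ?expn_gt0 ?nv // lognX => e'.
by rewrite -(leq_pmul2r lj) -e' leq_addr.
Qed.

End Conditions.

Lemma sval_inj (T : Type) (P : T -> Prop) (a b : {x | P x}) :
  sval a = sval b -> a = b.
Proof.
case: a b => [a pa] [b pb] /= e; rewrite -e in pb *.
by rewrite (proof_irrelevance _ pa pb).
Qed.

(** * The group L x| Z^d and the space Omega *)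

Section Localization.

Variables (d : nat) (I : Pol d -> Prop).
Hypothesis idI : is_ideal I.

Lemma lequiv_refl r : lequiv I r r.
Proof. by exists 0%MM; rewrite subrr mulr0; apply: (ideal0 idI). Qed.

Lemma lequiv_sym r s : lequiv I r s -> lequiv I s r.
Proof.
by move=> [k Ik]; exists k; apply: ideal_eq (idealN idI Ik); ring.
Qed.

Lemma lequiv_trans s r t : lequiv I r s -> lequiv I s t -> lequiv I r t.
Proof.
(* The middle denominator [s.1] joins the multipliers because it has to be cancelled, and monomials
   are not assumed regular at this point. *)
move=> [k Ik] [l Il]; exists (k + l + s.1)%MM; rewrite !monoD.
apply: ideal_eq (idealD idI (idealM idI (mono l * mono t.1) Ik)
  (idealM idI (mono k * mono r.1) Il)); ring.
Qed.

Lemma lclass_eq r s : lequiv I r s -> lclass I r = lclass I s.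
Proof.
move=> rs; apply: sval_inj; apply: functional_extensionality => t /=.
apply: propositional_extensionality; split; first exact: lequiv_trans (lequiv_sym rs).
exact: lequiv_trans rs.
Qed.

Lemma lclass_inj r s : lclass I r = lclass I s -> lequiv I r s.
Proof.
move=> /(f_equal sval) /= e; rewrite e; exact: lequiv_refl.
Qed.

Lemma lrepK (v : LCl I) : lclass I (lrep v) = v.
Proof.
apply: sval_inj => /=; rewrite /lrep.
by case: constructive_indefinite_description.
Qed.

Lemma lrep_class r : lequiv I (lrep (lclass I r)) r.
Proof. by apply: lclass_inj; rewrite lrepK. Qed.

Lemma ladd_class r s :
  ladd (lclass I r) (lclass I s)
  = lclass I ((r.1 + s.1)%MM, mono s.1 * r.2 + mono r.1 * s.2).
Proof.
have [k Ik] := lrep_class r; have [l Il] := lrep_class s.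
rewrite /ladd; set r' := lrep _ in Ik *; set s' := lrep _ in Il *.
apply: lclass_eq; exists (k + l)%MM; rewrite !monoD /=.
apply: ideal_eq (idealD idI (idealM idI (mono l * mono s.1 * mono s'.1) Ik)
  (idealM idI (mono k * mono r.1 * mono r'.1) Il)).
rewrite ?monoD; ring.
Qed.

Lemma lmono_class n r :
  lmono n (lclass I r) = lclass I ((r.1 + zneg n)%MM, mono (zpos n) * r.2).
Proof.
have [k Ik] := lrep_class r; rewrite /lmono; set r' := lrep _ in Ik *.
apply: lclass_eq; exists k => /=.
apply: ideal_eq (idealM idI (mono (zpos n) * mono (zneg n)) Ik).
rewrite ?monoD; ring.
Qed.

Lemma emb_cong x y : cong I x y -> emb I x = emb I y.
Proof.
move=> xy; apply: lclass_eq; exists 0%MM => /=.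
by rewrite !mono0 !mul1r.
Qed.

(** The affine maps x -> s + u^n x with s in R and n in N^d. They map R into itself, so they are
    defined on all of Omega ([Dom_gi]). *)
Definition gi (s : Pol d) (n : 'X_{1..d}) : Grp I :=
  (emb I s, fun i => Posz (n i)).

Definition tau (s : Pol d) := gi s 0%MM.

Lemma zpos_Posz (n : 'X_{1..d}) : zpos (fun i => Posz (n i)) = n.
Proof. by apply/mnmP => i; rewrite mnmE. Qed.

Lemma zneg_Posz (n : 'X_{1..d}) : zneg (fun i => Posz (n i)) = 0%MM.
Proof. by apply/mnmP => i; rewrite mnmE. Qed.

Lemma ladd_emb x y : ladd (emb I x) (emb I y) = emb I (x + y).
Proof. by rewrite /emb ladd_class /= mono0 !mul1r addm0. Qed.

Lemma lmono_emb (n : 'X_{1..d}) x :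
  lmono (fun i => Posz (n i)) (emb I x) = emb I (mono n * x).
Proof. by rewrite /emb lmono_class /= zpos_Posz zneg_Posz addm0. Qed.

Lemma gact_gi s n x : gact (gi s n) (emb I x) = emb I (s + mono n * x).
Proof. by rewrite /gact /= lmono_emb ladd_emb. Qed.

Lemma gmul_gi s n s' n' :
  gmul (gi s n) (gi s' n') = gi (s + mono n * s') (n + n')%MM.
Proof.
rewrite /gmul /= lmono_emb ladd_emb; congr pair.
by apply: functional_extensionality => i; rewrite mnmDE PoszD.
Qed.

Lemma gmul_tau s s' : gmul (tau s) (tau s') = tau (s + s').
Proof. by rewrite gmul_gi mono0 mul1r addm0. Qed.

Lemma gi_cong s s' n : cong I s s' -> gi s n = gi s' n.
Proof. by move=> /emb_cong e; rewrite /gi e. Qed.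

Lemma gone_tau : gone I = tau 0.
Proof.
by congr pair; apply: functional_extensionality => i; rewrite mnm0E.
Qed.

Lemma gmul_gone g : gmul g (gone I) = g.
Proof.
case: g => v n; rewrite /gmul /=; congr pair; last first.
  by apply: functional_extensionality => i; rewrite addr0.
rewrite -[v in RHS]lrepK -{1}[v]lrepK -/(emb I 0) /emb lmono_class ladd_class /=.
apply: lclass_eq; exists 0%MM => /=; rewrite !monoD !mono0.
by apply: ideal_eq (ideal0 idI); ring.
Qed.

Hypothesis regI : u_regular I.

Lemma emb_inj x y : emb I x = emb I y -> cong I x y.
Proof.
move=> /lclass_inj [k /=]; rewrite !mono0 !mul1r; exact: regI.
Qed.

Lemma tau_inj s s' : tau s = tau s' -> cong I s s'.
Proof. by move=> /(f_equal fst) /emb_inj. Qed.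

(** The equation v + u^n x = y, multiplied by the denominators of v and of u^n, becomes an equation
    in R. *)
Lemma gactP v n x y : gact (v, n) (emb I x) = emb I y ->
  I (mono (zneg n) * (lrep v).2 + mono (lrep v).1 * mono (zpos n) * x
     - mono (lrep v).1 * mono (zneg n) * y).
Proof.
rewrite -{1}[v]lrepK /gact /emb /= lmono_class ladd_class /=.
move=> /lclass_inj [k /= /regI]; rewrite !monoD !mono0 => Ik.
by apply: ideal_eq Ik; ring.
Qed.

(** Subtracting two instances of [gactP] removes the translation part and leaves the linear one. *)
Lemma gact_diff v n x y x' y' :
  gact (v, n) (emb I x) = emb I y -> gact (v, n) (emb I x') = emb I y' ->
  cong I (mono (zpos n) * (x - x')) (mono (zneg n) * (y - y')).
Proof.
move=> /gactP Ixy /gactP Ixy'; apply: (regI (n := (lrep v).1)).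
by apply: ideal_eq (idealB idI Ixy Ixy'); ring.
Qed.

Lemma gact_translation v n x y : n =1 (fun=> 0) ->
  gact (v, n) (emb I x) = emb I y -> (v, n) = tau (y - x).
Proof.
move=> n0; have -> : n = (fun i => Posz (0%MM i)).
  by apply: functional_extensionality => i; rewrite n0 mnm0E.
move=> /gactP; rewrite zneg_Posz zpos_Posz !mono0 => Ixy; congr pair.
rewrite -[LHS]lrepK; apply: lclass_eq; exists 0%MM => /=.
by apply: ideal_eq Ixy; rewrite mono0; ring.
Qed.

(** Conjugation by an affine map acts on translations through its linear part. This is the source of
    [li_equiv]. *)
Lemma gmul_tau_conj g s s' : gmul g (tau s) = gmul (tau s') g ->
  cong I (mono (zpos g.2) * s) (mono (zneg g.2) * s').
Proof.
case: g => v n /(f_equal fst) /=; rewrite -{1 2}[v]lrepK /emb !lmono_class.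
rewrite !ladd_class /= => /lclass_inj [k /= /regI].
rewrite zneg_Posz zpos_Posz !monoD !mono0 => Ik.
apply: (regI (n := (lrep v).1 + (lrep v).1)%MM); rewrite !monoD.
by apply: ideal_eq Ik; ring.
Qed.

End Localization.

(** * The u-adic filtration and neighbourhoods in Omega *)

Section Levels.

Variables (d : nat) (I : Pol d -> Prop).
Hypothesis idI : is_ideal I.

Definition mfull N : 'X_{1..d} := [multinom N | _ < d].

(* u^N R; the conjunct True makes it syntactically a [cons_img] of [cons_top]. *)
Definition lev N : Pol d -> Prop :=
  fun x => exists c, True /\ cong I x (mono (mfull N) * c).

Lemma constructible_lev N : constructible I (lev N).
Proof. by apply: cons_img; apply: cons_top. Qed.

Lemma levP N x : lev N x <-> exists c, cong I x (mono (mfull N) * c).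
Proof. by split=> [[c [_ xc]]|[c xc]]; exists c. Qed.

Lemma mfullD N M : mfull (N + M) = (mfull N + mfull M)%MM.
Proof. by apply/mnmP => i; rewrite mnmDE !mnmE. Qed.

Lemma lev_top x : lev 0 x.
Proof.
apply/levP; exists x.
have -> : mfull 0 = 0%MM by apply/mnmP => i; rewrite !mnmE.
by rewrite mono0 mul1r; apply: (cong_refl idI).
Qed.

Lemma lev0 N : lev N 0.
Proof. by apply/levP; exists 0; rewrite mulr0; apply: (cong_refl idI). Qed.

Lemma levD N x y : lev N x -> lev N y -> lev N (x + y).
Proof.
move=> /levP [c xc] /levP [c' yc]; apply/levP; exists (c + c').
by rewrite mulrDr; apply: (congD idI).
Qed.

Lemma levN N x : lev N x -> lev N (- x).
Proof.
move=> /levP [c xc]; apply/levP; exists (- c).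
by rewrite mulrN; apply: (congN idI).
Qed.

Lemma levB N x y : lev N x -> lev N y -> lev N (x - y).
Proof. by move=> lx ly; apply: levD => //; apply: levN. Qed.

Lemma levM N a x : lev N x -> lev N (a * x).
Proof.
move=> /levP [c xc]; apply/levP; exists (a * c).
by rewrite mulrCA; apply: (congM idI).
Qed.

Lemma lev_cong N x y : cong I x y -> lev N x -> lev N y.
Proof.
move=> xy /levP [c xc]; apply/levP; exists c.
by apply: (cong_trans idI) xc; apply: (cong_sym idI).
Qed.

Lemma lev_mono N c : lev N (mono (mfull N) * c).
Proof. by apply/levP; exists c; apply: (cong_refl idI). Qed.

Lemma lev_shift N M c : lev M c -> lev (N + M) (mono (mfull N) * c).
Proof.
move=> /levP [c' cc]; apply/levP; exists c'.
by rewrite mfullD monoD -mulrA; apply: (congM idI).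
Qed.

Lemma lev_le N M x : (N <= M)%N -> lev M x -> lev N x.
Proof.
move=> /subnKC <- /levP [c xc]; apply/levP.
by exists (mono (mfull (M - N)) * c); rewrite mulrA -monoD -mfullD.
Qed.

Lemma constructible_subgroup C : constructible I C ->
  [/\ C 0, (forall x y, C x -> C y -> C (x - y)) &
      (forall x y, cong I x y -> C x -> C y)].
Proof.
elim=> [|n D _ [D0 DB Dc]|n D _ [D0 DB Dc]] //; split.
- by exists 0; split=> //; rewrite mulr0; apply: (cong_refl idI).
- move=> x y [c [Dx xc]] [c' [Dy yc]]; exists (c - c'); split; first exact: DB.
  by rewrite mulrBr; apply: (congD idI) => //; apply: (congN idI).
- move=> x y xy [c [Dx xc]]; exists c; split=> //.
  by apply: (cong_trans idI) xc; apply: (cong_sym idI).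
- by rewrite mulr0.
- by move=> x y; rewrite mulrBr; apply: DB.
- by move=> x y xy; apply: Dc; apply: (congM idI).
Qed.

(** The subgroups u^N R are cofinal among the constructible ones. An image under u^n raises the
    level by the degree of n, which bounds every exponent of n; a preimage leaves it unchanged. *)
Lemma constructible_lev_sub C : constructible I C ->
  exists N, forall x, lev N x -> C x.
Proof.
elim=> [|n D cD [N ND]|n D cD [N ND]]; first by exists 0%N.
- exists (mdeg n + N)%N => x /levP [c xc].
  exists (mono (mfull (mdeg n) - n)%MM * (mono (mfull N) * c)); split.
    by apply: ND; apply: levM; apply: lev_mono.
  rewrite mulrA -monoD mulrA -monoD.
  suff -> : (n + (mfull (mdeg n) - n) + mfull N)%MM = mfull (mdeg n + N) by [].
  apply/mnmP => i; rewrite !mnmE subnKC // mdegE (bigD1 i) //=; exact: leq_addr.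
- by exists N => x lx; apply: ND; apply: levM.
Qed.

(* w lies in x + u^N Omega. *)
Definition near N (w : Om I) x := sval w (lev N) x.

Lemma near_ex N w : exists x, near N w x.
Proof.
have [+ _ _] := svalP w; move=> /(_ _ (constructible_lev N)) [x xw].
by exists x; apply/xw; rewrite subrr; apply: lev0.
Qed.

Lemma Om_coset (w : Om I) C x y : constructible I C -> sval w C x ->
  sval w C y <-> C (y - x).
Proof.
move=> cC wx; have [+ _ _] := svalP w; move=> /(_ _ cC) [z zw].
have [_ CB Cc] := constructible_subgroup cC.
have {wx} zx := (zw x).1 wx; have [C0 _ _] := constructible_subgroup cC.
split=> [/(zw y).1 zy|yx].
  by have := CB _ _ zy zx; rewrite opprB addrA subrK.
apply/zw; have Cxz := CB _ _ C0 zx; have := CB _ _ yx Cxz.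
by rewrite sub0r !opprB addrA subrK.
Qed.

Lemma nearP N w x y : near N w x -> near N w y <-> lev N (y - x).
Proof. by apply: Om_coset; apply: constructible_lev. Qed.

Lemma near_le N M w x : (N <= M)%N -> near M w x -> near N w x.
Proof.
move=> NM; have [_ + _] := svalP w; move=> wle; rewrite /near.
by apply: wle; [exact: constructible_lev..| move=> y; exact: lev_le].
Qed.

Lemma near_iota N x y : near N (Defs.iota I x) y <-> lev N (y - x).
Proof. by split=> [[]|] //; split => //; apply: constructible_lev. Qed.

Lemma near_agree_lev N w w' x :
  agree [:: lev N] w w' -> near N w x -> near N w' x.
Proof. by move=> /(_ (lev N) (or_introl erefl)) ww /ww. Qed.

(** By cofinality the cosets of the u^N form a basis of neighbourhoods, which allows continuity to
    be expressed by [near] with a single level. *)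
Lemma near_agree Cs : exists N, forall w w' x,
  near N w x -> near N w' x -> agree Cs w w'.
Proof.
elim: Cs => [|C Cs [N IH]]; first by exists 0%N => w w' x _ _ C [].
have [M HM] : exists M, forall w w' x, near M w x -> near M w' x ->
    forall y, sval w C y <-> sval w' C y.
  case: (classic (constructible I C)) => [cC|nC]; last first.
    (* Every point of Omega is empty at a set that is not constructible, so such a set imposes no
       condition. *)
    exists 0%N => w w' x _ _ y.
    have [_ _ n1] := svalP w; have [_ _ n2] := svalP w'.
    by split=> h; case: (n1 _ nC y) || case: (n2 _ nC y).
  have [M MC] := constructible_lev_sub cC; exists M => w w' x wx wx' y.
  have wC (v : Om I) : near M v x -> sval v C x.
    have [_ + _] := svalP v; move=> vle; apply: vle => //.
    exact: constructible_lev.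
  have [w1 w2] := (wC _ wx, wC _ wx').
  by rewrite (Om_coset y cC w1) (Om_coset y cC w2).
exists (maxn N M) => w w' x wx wx' D /= [<-|DCs] y.
  by apply: (HM _ _ x); [apply: near_le wx|apply: near_le wx']; rewrite leq_maxr.
by apply: (IH _ _ x) DCs _; [apply: near_le wx|apply: near_le wx']; rewrite leq_maxl.
Qed.

Lemma Om_ext (w w' : Om I) :
  (forall N, exists x, near N w x /\ near N w' x) -> w = w'.
Proof.
move=> ww; apply: sval_inj; apply: functional_extensionality => C.
apply: functional_extensionality => y; apply: propositional_extensionality.
have [N HN] := near_agree [:: C]; have [x [wx wx']] := ww N.
exact: (HN _ _ _ wx wx' C (or_introl erefl) y).
Qed.

End Levels.

(** * Finite quotients and compactness of Omega *)

Section Compactness.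

Variables (d : nat) (I : Pol d -> Prop).
Hypotheses (idI : is_ideal I) (d_gt0 : (0 < d)%N).
Hypotheses (condb : cond_b I) (condd : cond_d I).

(** Choose k with kR inside uR and reduce the coordinates modulo k: the finitely many vectors of
    remainders represent all classes modulo u. *)
Lemma finite_quotient : exists (T : finType) (e : T -> Pol d),
  forall z, exists t, lev I 1 (z - e t).
Proof.
have [r [b bb]] := exists_Zbasis d_gt0 condd.
have [[//|k] _ kP] := mono_finite_index idI d_gt0 condb condd (mfull d 1).
exists {ffun 'I_r -> 'I_k.+1}.
exists (fun t : {ffun 'I_r -> 'I_k.+1} => lincomb b (\row_i (t i : nat)%:Z)) => z.
pose q := \row_i divz (zcoord bb z 0 i) k.+1%:Z.
exists [ffun i => inord `|modz (zcoord bb z 0%R i) k.+1%:Z|%N].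
set s := \row_i _; have e : zcoord bb z = k.+1%:Z *: q + s.
  apply/rowP => i; rewrite !mxE ffunE mulrC.
  have r0 : 0 <= modz (zcoord bb z 0 i) k.+1%:Z by apply: modz_ge0.
  have rk : modz (zcoord bb z 0 i) k.+1%:Z < k.+1%:Z by apply: ltz_pmod.
  rewrite inordK; last by rewrite -ltz_nat gez0_abs.
  by rewrite gez0_abs // -divz_eq.
have [c kc] := kP (lincomb b q).
apply: (lev_cong idI (x := mono (mfull d 1) * c)); last exact: (lev_mono idI).
apply: (cong_trans idI) (cong_sym idI kc) _; apply: (cong_sym idI).
have := zcoordP bb z; rewrite e lincombD lincombZ => zc.
apply: cong_eq zc; rewrite -mul_mpolyC -natz rmorph_nat; ring.
Qed.

(* Koenig's lemma on the finitely branching tree of cosets of u^N. *)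
Lemma uniformly_locally_constant (T : Type) (F : Om I -> T) :
  (forall w, exists N, forall w' x, near N w x -> near N w' x -> F w' = F w) ->
  exists N, forall w w' x, near N w x -> near N w' x -> F w = F w'.
Proof.
(* A coset is good if one level works on all of it. If the root were bad, a branch of bad cosets
   would converge to a point where [F] is not locally constant. *)
move=> Floc; pose good N x := exists M, forall z w w',
  near N w x -> near M w z -> near M w' z -> F w = F w'.
apply: NNPP => nunif.
have bad0 : ~ good 0%N 0.
  move=> [M HM]; apply: nunif; exists M => w w' x; apply: HM.
  by have [y wy] := near_ex idI 0 w; apply/(nearP idI _ wy); apply: (lev_top idI).
(* The implication stands under the existential so that the choice function [nxt] is total. *)
have step N x : exists y, ~ good N x -> lev I N (y - x) /\ ~ good N.+1 y.
  have [[y yP]|nstep] := classic (exists y, lev I N (y - x) /\ ~ good N.+1 y).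
    by exists y.
  exists x => bad; exfalso; apply: bad.
  have [J [e eP]] := finite_quotient.
  pose y j := x + mono (mfull d N) * e j.
  have goody j : {M | forall z w w', near N.+1 w (y j) -> near M w z ->
      near M w' z -> F w = F w'}.
    apply: constructive_indefinite_description; apply: NNPP => ngood.
    apply: nstep; exists (y j); split => //.
    by rewrite addrC addrA addNr add0r; apply: (lev_mono idI).
  (* The maximum over the finitely many children serves the parent; [N.+1] makes the level fine
     enough for z to determine the child. *)
  exists (maxn N.+1 (\max_j sval (goody j))) => z w w' wx wz wz'.
  have wz1 : near N.+1 w z by apply: near_le wz; rewrite leq_maxl.
  have /levP [c zc] := (nearP idI z wx).1 (near_le (leqnSn N) wz1).
  have [j cj] := eP c.
  have leM : (sval (goody j) <= maxn N.+1 (\max_j sval (goody j)))%N.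
    by apply: leq_trans (leq_maxr _ _); apply: (leq_bigmax j).
  apply: (svalP (goody j) z); last 2 first.
  - exact: (near_le leM).
  - exact: (near_le leM).
  apply/(nearP idI _ wz1).
  have := levN idI (lev_shift idI N cj); rewrite addn1; apply: (lev_cong idI).
  by apply: cong_eq zc; rewrite /y; ring.
pose nxt N x := sval (constructive_indefinite_description _ (step N x)).
have nxtP N x : ~ good N x -> lev I N (nxt N x - x) /\ ~ good N.+1 (nxt N x).
  exact: (svalP (constructive_indefinite_description _ (step N x))).
pose x := fix x N := if N is N'.+1 then nxt N' (x N') else 0.
have badx N : ~ good N (x N).
  by elim: N => [//|N IH]; have [] := nxtP _ _ IH.
have xlev N k : lev I N (x (N + k)%N - x N).
  elim: k => [|k IH]; first by rewrite addn0 subrr; apply: (lev0 idI).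
  rewrite addnS /=; have [+ _] := nxtP _ _ (badx (N + k)%N).
  move=> /(lev_le (leq_addr k N)) h; have := levD idI h IH.
  by rewrite addrA subrK.
(* The limit of the branch: its coset of C is that of [x N] for N so large that C contains u^N R. By
   [w0E] the choice of N does not matter. *)
pose w0 C y := constructible I C /\
  exists2 N, (forall z, lev I N z -> C z) & C (y - x N).
have w0E C N : constructible I C -> (forall z, lev I N z -> C z) ->
    forall y, w0 C y <-> C (y - x N).
  move=> cC NC y; split=> [[_ [M MC yM]]|yN]; last by split=> //; exists N.
  have [C0 CB _] := constructible_subgroup idI cC.
  have CMN : C (x (maxn N M) - x N).
    by apply: NC; rewrite -(subnKC (leq_maxl N M)).
  have CMM : C (x (maxn N M) - x M).
    by apply: MC; rewrite -(subnKC (leq_maxr N M)).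
  have := CB _ _ yM (CB _ _ CMM CMN).
  by congr C; ring.
have w0P : is_Om_point I w0.
  split=> [C cC|C D cC cD CD y [_ [N NC yN]]|C nC y []//].
    have [N NC] := constructible_lev_sub idI cC; exists (x N); exact: w0E.
  by split=> //; exists N; [move=> z /NC /CD|apply: CD].
pose w : Om I := exist _ w0 w0P.
have wx N : near N w (x N).
  apply/(w0E (lev I N) N) => //; first exact: constructible_lev.
  by rewrite subrr; apply: (lev0 idI).
have [N HN] := Floc w; apply: (badx N); exists N => z w1 w2 w1x w1z w2z.
rewrite (HN w1 (x N)) // (HN w2 (x N)) //.
by apply/(nearP idI _ w2z); apply/(nearP idI _ w1z).
Qed.

End Compactness.

(** * The cocycle of a groupoid isomorphism *)

Section Extension.

Variables (d : nat) (I : Pol d -> Prop).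
Variables (Dom : Grp I -> Om I -> Prop) (th : Grp I -> Om I -> Om I).
Hypotheses (idI : is_ideal I) (ext : is_Om_ext Dom th).

(** The points of R that g sends into R are dense in [Dom g], and continuity of [th g] controls
    their images at the same time. *)
Lemma Dom_approx g w Cs Cs' : Dom g w -> exists x y,
  [/\ agree Cs w (Defs.iota I x), gact g (emb I x) = emb I y &
      agree Cs' (th g w) (Defs.iota I y)].
Proof.
case: ext => DomP thP [_ _ _ topo] gw.
have [_ /(_ w gw Cs') [Ds HDs]] := topo g.
have [w' [[x [y [-> gxy]]] ag]] := (DomP g w).1 gw (Cs ++ Ds).
exists x, y; split=> // [C inC|]; first by apply: ag; apply/List.in_app_iff; left.
rewrite -(thP _ _ _ gxy); apply: HDs => [|C inC]; last first.
  by apply: ag; apply/List.in_app_iff; right.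
by apply/DomP => Cs''; exists (Defs.iota I x); split; [exists x, y|].
Qed.

Lemma agree_iota_near M w x :
  agree [:: lev I M] w (Defs.iota I x) -> near M w x.
Proof.
move=> ag; apply/(ag (lev I M)); first by left.
by apply/near_iota; rewrite subrr; apply: (lev0 idI).
Qed.

Lemma Dom_near g w M L : Dom g w -> exists x y,
  [/\ near M w x, gact g (emb I x) = emb I y & near L (th g w) y].
Proof.
move=> /(Dom_approx [:: lev I M] [:: lev I L]) [x [y [wx gxy wy]]].
by exists x, y; split=> //; apply: agree_iota_near.
Qed.

Lemma Dom_gi s n w : Dom (gi I s n) w.
Proof.
case: ext => DomP _ _; apply/DomP => Cs; have [N HN] := near_agree idI Cs.
have [x wx] := near_ex idI N w; exists (Defs.iota I x); split.
  by exists x, (s + mono n * x); rewrite gact_gi.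
by apply: (HN _ _ x) => //; apply/near_iota; rewrite subrr; apply: (lev0 idI).
Qed.

Lemma Dom_gone w : Dom (gone I) w.
Proof. by rewrite gone_tau; apply: Dom_gi. Qed.

Hypothesis regI : u_regular I.

Lemma near_th_gi s n w N x :
  near N w x -> near N (th (gi I s n) w) (s + mono n * x).
Proof.
move=> wx; have [x' [y [wx' + wy]]] := Dom_near N N (Dom_gi s n w).
rewrite gact_gi // => /(emb_inj idI regI) xy.
apply/(nearP idI _ wy); have := levM idI (mono n) ((nearP idI _ wx').1 wx).
apply: (lev_cong idI); apply: cong_eq (congN idI xy); ring.
Qed.

Lemma near_th_tau s w N x : near N w x -> near N (th (tau I s) w) (s + x).
Proof. by move=> /(near_th_gi s 0%MM); rewrite mono0 mul1r. Qed.

End Extension.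

Section Morphism.

Variables (d1 d2 : nat) (I1 : Pol d1 -> Prop) (I2 : Pol d2 -> Prop).
Variables (Dom1 : Grp I1 -> Om I1 -> Prop) (th1 : Grp I1 -> Om I1 -> Om I1).
Variables (Dom2 : Grp I2 -> Om I2 -> Prop) (th2 : Grp I2 -> Om I2 -> Om I2).
Hypotheses (idI1 : is_ideal I1) (ext1 : is_Om_ext Dom1 th1).
Variable phi : Grp I1 * Om I1 -> Grp I2 * Om I2.
Hypothesis phiM : gpd_morph Dom1 th1 Dom2 th2 phi.

(** The cocycle of [phi]; with the map [ubase] of unit spaces it determines [phi] on arrows, by
    [phiE]. *)
Definition coc g w := (phi (g, w)).1.
Definition ubase w := (phi (gone I1, w)).2.

Lemma th1_gone w : th1 (gone I1) w = w.
Proof. by case: ext1 => _ _ []. Qed.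

(** Compose the arrow with the unit at its source: the image of a product has the source of the
    image of its right factor. *)
Lemma phiE g w : Dom1 g w -> phi (g, w) = (coc g w, ubase w).
Proof.
move=> gw; case: phiM => _ mulP _.
have := mulP (gone I1) g w (Dom_gone idI1 ext1 w).
rewrite th1_gone gmul_gone // => /(_ gw) [_ e].
by rewrite [LHS]surjective_pairing {2}e.
Qed.

Lemma coc_Dom g w : Dom1 g w -> Dom2 (coc g w) (ubase w).
Proof.
by move=> gw; case: phiM => /(_ (g, w) gw); rewrite /arrow phiE.
Qed.

Lemma ubase_th g w : Dom1 g w -> ubase (th1 g w) = th2 (coc g w) (ubase w).
Proof.
move=> gw; case: phiM => _ mulP _.
have [e _] := mulP g (gone I1) w gw (Dom_gone idI1 ext1 _).
by rewrite {1}/ubase e phiE.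
Qed.

Lemma coc_mul g h w : Dom1 g w -> Dom1 h (th1 g w) ->
  coc (gmul h g) w = gmul (coc h (th1 g w)) (coc g w).
Proof.
by move=> gw hw; case: phiM => _ /(_ g h w gw hw) [_]; rewrite /coc => ->.
Qed.

Lemma coc_tauD a a' w :
  coc (tau I1 (a + a')) w
  = gmul (coc (tau I1 a) (th1 (tau I1 a') w)) (coc (tau I1 a') w).
Proof. by rewrite -gmul_tau // coc_mul //; apply: (Dom_gi idI1 ext1). Qed.

Lemma coc_locally_constant g w : Dom1 g w ->
  exists N, forall w' x, near N w x -> near N w' x -> Dom1 g w' ->
    coc g w' = coc g w.
Proof.
move=> gw; case: phiM => _ _ /(_ g w gw [::]) [Cs HCs].
have [N HN] := near_agree idI1 Cs; exists N => w' x wx wx' gw'.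
by have [] := HCs w' gw' (HN _ _ x wx wx').
Qed.

Lemma ubase_continuous w K : exists N, forall w' x y,
  near N w x -> near N w' x -> near K (ubase w) y -> near K (ubase w') y.
Proof.
case: phiM => _ _ /(_ _ w (Dom_gone idI1 ext1 w) [:: lev I2 K]) [Cs HCs].
have [N HN] := near_agree idI1 Cs; exists N => w' x y wx wx'.
have [_ ag] := HCs w' (Dom_gone idI1 ext1 w') (HN _ _ x wx wx').
exact: (near_agree_lev ag).
Qed.

Hypotheses (d1_gt0 : (0 < d1)%N) (condb1 : cond_b I1) (condd1 : cond_d I1).

Lemma coc_tau_uniform1 b : exists N, forall w w' x,
  near N w x -> near N w' x -> coc (tau I1 b) w = coc (tau I1 b) w'.
Proof.
apply: (uniformly_locally_constant idI1 d1_gt0 condb1 condd1) => w.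
have [N HN] := coc_locally_constant (Dom_gi idI1 ext1 b 0%MM w).
exists N => w' x wx wx'; apply: (HN _ x) => //; exact: (Dom_gi idI1 ext1).
Qed.

Hypothesis regI1 : u_regular I1.

(* R is finitely generated as an additive monoid. *)
Lemma coc_tau_uniform : exists N, forall b w w' x,
  near N w x -> near N w' x -> coc (tau I1 b) w = coc (tau I1 b) w'.
Proof.
have [r [b bb]] := exists_Zbasis d1_gt0 condd1.
pose lvl a := sval (constructive_indefinite_description _ (coc_tau_uniform1 a)).
have lvlP a : forall w w' x, near (lvl a) w x -> near (lvl a) w' x ->
    coc (tau I1 a) w = coc (tau I1 a) w'.
  exact: (svalP (constructive_indefinite_description _ (coc_tau_uniform1 a))).
(* A common bound for the levels of 0, of the basis elements and of their negatives, which generate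
   R as a monoid. *)
exists (lvl 0%R + \max_i (lvl (b i) + lvl (- b i)%R))%N; set N := addn _ _.
pose S a := forall w w' x, near N w x -> near N w' x ->
  coc (tau I1 a) w = coc (tau I1 a) w'.
have SS a : (lvl a <= N)%N -> S a.
  by move=> aN w w' x wx wx'; apply: (lvlP _ _ _ x); apply: near_le aN _.
have S0 : S 0 by apply: SS; apply: leq_addr.
have lb i : (lvl (b i) + lvl (- b i)%R <= N)%N.
  apply: leq_trans (leq_addl _ _).
  exact: (leq_bigmax (F := fun i => (lvl (b i) + lvl (- b i)%R)%N) i).
have Sp i : S (b i) by apply: SS; apply: leq_trans (lb i); apply: leq_addr.
have Sn i : S (- b i) by apply: SS; apply: leq_trans (lb i); apply: leq_addl.
(* The level does not grow under sums: translating two points of one coset of u^N by the same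
   element leaves them in one coset. *)
have SD a a' : S a -> S a' -> S (a + a').
  move=> Sa Sa' w w' x wx wx'; rewrite (coc_tauD a a' w) (coc_tauD a a' w').
  rewrite (Sa' w w' x wx wx') (Sa _ (th1 (tau I1 a') w') (a' + x)) //;
    exact: (near_th_tau idI1 ext1 regI1).
have SMn a n : S a -> S (a *+ n).
  by move=> Sa; elim: n => [|n IH]; rewrite ?mulr0n // mulrS; apply: SD.
move=> a; have -> : tau I1 a = tau I1 (lincomb b (zcoord bb a)).
  by apply: gi_cong => //; apply: zcoordP.
apply: (big_ind S) => // i _; case: (zcoord bb a 0 i) => n.
  by rewrite -natz scaler_nat; apply: SMn.
by rewrite NegzE scaleNr -natz scaler_nat -mulNrn; apply: SMn.
Qed.

End Morphism.

(* The values of r matter only on [lev I1 N]; the p - q of [li_equiv] is the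
   exponent t(n). *)
Record local_intertwiner d1 d2 (I1 : Pol d1 -> Prop) (I2 : Pol d2 -> Prop)
    (N : nat) (r : Pol d1 -> Pol d2) : Prop := LocalIntertwiner {
  li_cong : forall x y, lev I1 N x -> cong I1 x y -> cong I2 (r x) (r y);
  li_add : forall x y, lev I1 N x -> lev I1 N y ->
    cong I2 (r (x + y)) (r x + r y);
  li_cont : forall K, exists M, forall x, lev I1 M x -> lev I2 K (r x);
  li_equiv : forall n : 'X_{1..d1}, exists p q M, (N <= M)%N /\
    forall x, lev I1 M x -> cong I2 (mono p * r x) (mono q * r (mono n * x))
}.

Lemma mono_factor d (A : 'X_{1..d}) j :
  (0 < A j)%N -> mono A = 'X_j * mono (A - U_(j))%MM.
Proof.
move=> Aj; rewrite -[ 'X_j ]/(mono U_(j)%MM) -monoD; congr mono.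
apply/mnmP => i; rewrite mnmDE mnmBE mnm1E; case: eqP => [<-|_] /=.
  by rewrite subnKC.
by rewrite subn0.
Qed.

(** * Small translations are sent to translations *)

Section Half.

Variables (d1 d2 : nat) (I1 : Pol d1 -> Prop) (I2 : Pol d2 -> Prop).
Variables (Dom1 : Grp I1 -> Om I1 -> Prop) (th1 : Grp I1 -> Om I1 -> Om I1).
Variables (Dom2 : Grp I2 -> Om I2 -> Prop) (th2 : Grp I2 -> Om I2 -> Om I2).
Hypotheses (idI1 : is_ideal I1) (idI2 : is_ideal I2).
Hypotheses (ext1 : is_Om_ext Dom1 th1) (ext2 : is_Om_ext Dom2 th2).
Variables (phi : Grp I1 * Om I1 -> Grp I2 * Om I2).
Variables (psi : Grp I2 * Om I2 -> Grp I1 * Om I1).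
Hypotheses (phiM : gpd_morph Dom1 th1 Dom2 th2 phi).
Hypotheses (psiM : gpd_morph Dom2 th2 Dom1 th1 psi).
Hypotheses (phiK : forall a, arrow Dom1 a -> psi (phi a) = a).
Hypotheses (psiK : forall a, arrow Dom2 a -> phi (psi a) = a).
Hypotheses (d1_gt0 : (0 < d1)%N) (condb1 : cond_b I1) (condd1 : cond_d I1).
Hypotheses (regI1 : u_regular I1) (regI2 : u_regular I2).
Hypothesis indI2 : var_independent I2.

Lemma ubaseK w : ubase psi (ubase phi w) = w.
Proof.
have Dw := Dom_gone idI1 ext1 w; have := phiK (a := (gone I1, w)) Dw.
rewrite (phiE idI1 ext1 phiM Dw) (phiE idI2 ext2 psiM (coc_Dom idI1 ext1 phiM Dw)).
by case.
Qed.

Lemma ubaseVK w : ubase phi (ubase psi w) = w.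
Proof.
have Dw := Dom_gone idI2 ext2 w; have := psiK (a := (gone I2, w)) Dw.
rewrite (phiE idI2 ext2 psiM Dw) (phiE idI1 ext1 phiM (coc_Dom idI2 ext2 psiM Dw)).
by case.
Qed.

Lemma near_th_tau_lev N b w x :
  lev I1 N b -> near N w x -> near N (th1 (tau I1 b) w) x.
Proof.
move=> lb wx; have wbx := near_th_tau idI1 ext1 regI1 b wx.
by apply/(nearP idI1 _ wbx); rewrite opprD addrCA subrr addr0; apply: (levN idI1).
Qed.

Variables (N : nat) (w1 : Om I1).
Hypothesis unifN : forall b w w' x, near N w x -> near N w' x ->
  coc phi (tau I1 b) w = coc phi (tau I1 b) w'.

(** A translation by an element of u^N R keeps [w1] in its coset, where the cocycle does not change,
    so the cocycle identity becomes multiplicativity. *)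
Lemma coc_tauD_lev b b' : lev I1 N b' -> coc phi (tau I1 (b + b')) w1
  = gmul (coc phi (tau I1 b) w1) (coc phi (tau I1 b') w1).
Proof.
move=> lb; have [x wx] := near_ex idI1 N w1.
by rewrite (coc_tauD idI1 ext1 phiM b b' w1) (unifN b (near_th_tau_lev lb wx) wx).
Qed.

(* The Z^d2-component of rho(b). *)
Definition shift b j : int := (coc phi (tau I1 b) w1).2 j.

Lemma shiftD b b' j : lev I1 N b' -> shift (b + b') j = shift b j + shift b' j.
Proof. by move=> lb; rewrite /shift (coc_tauD_lev b lb). Qed.

Lemma shift0 j : shift 0 j = 0.
Proof.
have /eqP := shiftD 0 j (lev0 idI1 N).
by rewrite addr0 -subr_eq0 opprD addrA subrr sub0r oppr_eq0 => /eqP.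
Qed.

Lemma shiftMn b k j : lev I1 N b -> shift (k%:R * b) j = shift b j *+ k.
Proof.
move=> lb; elim: k => [|k IH]; first by rewrite mul0r shift0.
by rewrite -natr1 mulrDl mul1r shiftD // IH mulrSr.
Qed.

(* The k-th power of the affine map coc b moves two points at distance exactly
   u^K by less than u^(K+1) when kb is small, whereas its linear part would
   multiply their difference by a power of u_j. *)
Lemma shift_le0 b j : lev I1 N b -> ~~ (0 < shift b j).
Proof.
move=> lb; apply/negP => bj; set w2 := ubase phi w1.
(* Points within u^K of [w2] come from the coset of [w1] modulo u^N, on which the cocycle of a
   translation is constant. *)
have [K HK] := ubase_continuous idI2 ext2 psiM w2 N.
(* The second point lies at distance exactly u^K from [w2], close enough for the cocycle at its
   preimage to be the same ([alE]). *)
pose w2' := th2 (tau I2 (mono (mfull d2 K))) w2; pose w1' := ubase psi w2'.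
have w2'E : ubase phi w1' = w2' by apply: ubaseVK.
have [M0 HM0] := ubase_continuous idI1 ext1 phiM w1 K.+1.
have [M1 HM1] := ubase_continuous idI1 ext1 phiM w1' K.+1.
have [k k0 kP] := mono_finite_index idI1 d1_gt0 condb1 condd1
  (mfull d1 (maxn M0 M1)).
have lkb : lev I1 (maxn M0 M1) (k%:R * b) by apply/levP; apply: kP.
set al := coc phi (tau I1 (k%:R * b)) w1.
have alE : coc phi (tau I1 (k%:R * b)) w1' = al.
  have [y w2y] := near_ex idI2 K w2; have [z w1z] := near_ex idI1 N w1.
  apply: (unifN _ _ w1z); apply: (HK _ y) => //; last by rewrite ubaseK.
  have w2y' := near_th_tau idI2 ext2 regI2 (mono (mfull d2 K)) w2y.
  apply/(nearP idI2 _ w2y'); rewrite opprD addrCA subrr addr0.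
  by apply: (levN idI2); rewrite -[X in lev _ _ X]mulr1; apply: (lev_mono idI2).
(* By continuity of the base map the small translation by kb becomes a displacement by [al] inside
   u^(K+1) R, witnessed by points of R. *)
have move_small M w (K' := K.+1) : (M <= maxn M0 M1)%N ->
    (forall w' x y, near M w x -> near M w' x ->
      near K' (ubase phi w) y -> near K' (ubase phi w') y) ->
    coc phi (tau I1 (k%:R * b)) w = al ->
    exists x y, [/\ near K' (ubase phi w) x, gact al (emb I2 x) = emb I2 y &
      lev I2 K' (y - x)].
  move=> leM Hw wal; have Dw := Dom_gi idI1 ext1 (k%:R * b) 0%MM w.
  have := coc_Dom idI1 ext1 phiM Dw; rewrite -/(tau _ _) wal => Dal.
  have [x [y [wx gxy wy]]] := Dom_near idI2 ext2 K' K' Dal.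
  exists x, y; split=> //; have [z wz] := near_ex idI1 M w.
  have := ubase_th idI1 ext1 phiM Dw; rewrite -/(tau _ _) wal => thE.
  apply/(nearP idI2 (w := th2 al (ubase phi w))) => //; rewrite -thE.
  apply: (Hw _ z) => //; apply: near_th_tau_lev => //.
  exact: (lev_le leM).
have [x0 [y0 [wx0 g0 l0]]] := move_small _ _ (leq_maxl _ _) HM0 erefl.
have [x1 [y1 [wx1 g1 l1]]] := move_small _ _ (leq_maxr _ _) HM1 alE.
have wx0' := near_th_tau idI2 ext2 regI2 (mono (mfull d2 K)) wx0.
rewrite w2'E in wx1; have /levP [c xc] := (nearP idI2 _ wx0').1 wx1.
have /levP [c' yc] := levB idI2 l1 l0.
move: alE g0 g1; rewrite [al]surjective_pairing => _ g0 g1.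
have := gact_diff idI2 regI2 g1 g0.
set P := zpos al.2; set Q := zneg al.2 => PQ.
have alj : al.2 j = shift b j *+ k by rewrite -shiftMn.
have Pj : (0 < P j)%N.
  rewrite mnmE alj; move: bj; case: (shift b j) => // s; rewrite ltz_nat => s0.
  by rewrite -mulr_natr natz -PoszM muln_gt0 s0.
have Qj : Q j = 0%N.
  rewrite mnmE alj; move: bj; case: (shift b j) => // s _.
  by rewrite -mulr_natr natz -PoszM.
set u := mono (mfull d2 1); set uK := mono (mfull d2 K) in xc yc PQ.
have uE : mono (mfull d2 K.+1) = u * uK by rewrite -monoD -mfullD add1n.
rewrite uE in xc yc.
(* The differences of the two points before and after applying [al] are u^K(1 + uc) and u^K(1 + u(c
   + c')). The factor u^K cancels. *)
have /regI2 e : I2 (uK * (mono P * (1 + u * c) - mono Q * (1 + u * (c + c')))).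
  have h := idealB idI2 PQ (idealB idI2 (idealM idI2 (mono P - mono Q) xc)
    (idealM idI2 (mono Q) yc)).
  apply: ideal_eq h; ring.
(* Since u_j divides both u^P and u, it divides u^Q, whose exponent at j is 0. *)
have : cong I2 (mono Q) ('X_j ^+ 1 * (mono (P - U_(j))%MM * (1 + u * c)
    - mono Q * (mono (mfull d2 1 - U_(j))%MM * (c + c')))).
  have uj : u = 'X_j * mono (mfull d2 1 - U_(j))%MM.
    by apply: mono_factor; rewrite mnmE.
  have {}e := idealN idI2 e; apply: ideal_eq e; rewrite expr1.
  rewrite {2}uj (mono_factor Pj); ring.
by move=> /indI2; rewrite Qj.
Qed.

Lemma shift_eq0 b : lev I1 N b -> (coc phi (tau I1 b) w1).2 =1 (fun=> 0).
Proof.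
move=> lb j; rewrite -/(shift b j); apply/eqP.
have lN := levN idI1 lb.
have := shift_le0 j lb; have := shift_le0 j lN.
have : shift b j + shift (- b) j = 0 by rewrite -shiftD // subrr shift0.
lia.
Qed.

(** The shift vanishes, so the cocycle translates by an element of L. Its domain is not empty, so it
    sends some x in R to some y in R and the element is y - x. *)
Lemma coc_is_tau b : lev I1 N b -> exists s, coc phi (tau I1 b) w1 = tau I2 s.
Proof.
move=> lb; have Dal := coc_Dom idI1 ext1 phiM (Dom_gi idI1 ext1 b 0%MM w1).
have [x [y [_ gxy _]]] := Dom_near idI2 ext2 0 0 Dal.
exists (y - x); rewrite [LHS]surjective_pairing.
apply: (gact_translation idI2 regI2) => //.
exact: shift_eq0.
Qed.

Lemma local_intertwiner_exists : exists r, local_intertwiner I1 I2 N r /\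
  forall x, lev I1 N x -> phi (tau I1 x, w1) = (tau I2 (r x), ubase phi w1).
Proof.
have rex b : exists s, lev I1 N b -> coc phi (tau I1 b) w1 = tau I2 s.
  have [lb|nb] := classic (lev I1 N b); last by exists 0.
  by have [s sP] := coc_is_tau lb; exists s.
pose r b := sval (constructive_indefinite_description _ (rex b)).
have rP b : lev I1 N b -> coc phi (tau I1 b) w1 = tau I2 (r b).
  exact: (svalP (constructive_indefinite_description _ (rex b))).
exists r; split; last first.
  move=> x lx; rewrite (phiE idI1 ext1 phiM) ?rP //; exact: (Dom_gi idI1 ext1).
split.
- move=> x y lx xy; apply: (tau_inj idI2 regI2); rewrite -!rP //.
    by rewrite /tau (gi_cong idI1 _ xy).
  exact: (lev_cong idI1) xy lx.
- move=> x y lx ly; apply: (tau_inj idI2 regI2); rewrite -gmul_tau // -!rP //.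
    exact: coc_tauD_lev.
  exact: (levD idI1).
- move=> K; have [M HM] := ubase_continuous idI1 ext1 phiM w1 K.
  exists (maxn N M) => x lx; have [z wz] := near_ex idI1 M w1.
  have [y wy] := near_ex idI2 K (ubase phi w1).
  have lN : lev I1 N x by apply: lev_le lx; apply: leq_maxl.
  have lM : lev I1 M x by apply: lev_le lx; apply: leq_maxr.
  have := HM _ _ y wz (near_th_tau_lev lM wz) wy.
  rewrite (ubase_th idI1 ext1 phiM (Dom_gi idI1 ext1 x 0%MM w1)) -/(tau _ _) rP //.
  move=> wy'; have := near_th_tau idI2 ext2 regI2 (r x) wy.
  by move=> /(nearP idI2 _ wy'); rewrite addrK.
move=> n; have [x wx] := near_ex idI1 N w1.
(* An affine map with linear part u^n that fixes x, so that it keeps [w1] in its coset modulo u^N.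
   It satisfies g tau(b) = tau(u^n b) g, and the cocycle is applied to both sides. *)
set g := gi I1 (x - mono n * x) n.
have Dg w : Dom1 g w by apply: (Dom_gi idI1 ext1).
have gw : near N (th1 g w1) x.
  have := near_th_gi idI1 ext1 regI1 (x - mono n * x) n wx.
  by rewrite subrK.
have [M HM] := coc_locally_constant idI1 phiM (Dg w1).
exists (zpos (coc phi g w1).2), (zneg (coc phi g w1).2), (maxn N M).
split; first exact: leq_maxl.
move=> b lb; have lN : lev I1 N b by apply: lev_le lb; apply: leq_maxl.
have lM : lev I1 M b by apply: lev_le lb; apply: leq_maxr.
apply: (gmul_tau_conj idI2 regI2).
have Dt s w : Dom1 (tau I1 s) w by apply: (Dom_gi idI1 ext1).
rewrite -!rP //; last exact: (levM idI1).
have [z wz] := near_ex idI1 M w1.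
rewrite -{1}(HM _ z wz (near_th_tau_lev lM wz)) // -(coc_mul phiM) //.
rewrite -(unifN _ gw wx) -(coc_mul phiM) //; congr (coc phi _ w1).
rewrite /g !gmul_gi // mono0 mul1r addm0 add0m; congr gi; exact: addrC.
Qed.

End Half.

(** * Rigidity of intertwiners *)

Lemma monoMn d (A : 'X_{1..d}) k : mono (A *+ k)%MM = mono A ^+ k.
Proof. by rewrite /mono mpolyXn. Qed.

Lemma mono_factorX d (A : 'X_{1..d}) j k :
  (k <= A j)%N -> exists z, mono A = 'X_j ^+ k * z.
Proof.
move=> kA; exists (mono (A - U_(j) *+ k)%MM).
rewrite -[ 'X_j ]/(mono U_(j)%MM) -monoMn -monoD; congr mono.
apply/mnmP => i; rewrite mnmDE mnmBE mulmnE mnm1E; case: eqP => [<-|_] /=.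
  by rewrite mul1n subnKC.
by rewrite mul0n subn0.
Qed.

(** Each monomial is divisible in R by the powers of the variables that occur in the other. *)
Lemma mono_inj d (I : Pol d -> Prop) (A B : 'X_{1..d}) : is_ideal I ->
  var_independent I -> cong I (mono A) (mono B) -> A = B.
Proof.
move=> idI ind AB; apply/mnmP => j; apply/eqP; rewrite eqn_leq; apply/andP; split.
  have [z Az] := mono_factorX (leqnn (A j)).
  by apply: (ind _ _ _ z); rewrite -Az; apply: (cong_sym idI).
have [z Bz] := mono_factorX (leqnn (B j)).
by apply: (ind _ _ _ z); rewrite -Bz.
Qed.

Section Intertwiners.

Variables (d1 d2 : nat) (I1 : Pol d1 -> Prop) (I2 : Pol d2 -> Prop).
Hypotheses (idI1 : is_ideal I1) (idI2 : is_ideal I2).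
Hypotheses (regI1 : u_regular I1) (regI2 : u_regular I2).
Hypotheses (indI1 : var_independent I1) (indI2 : var_independent I2).
Variables (N1 N2 : nat) (r1 : Pol d1 -> Pol d2) (r2 : Pol d2 -> Pol d1).
Hypotheses (r1P : local_intertwiner I1 I2 N1 r1).
Hypotheses (r2P : local_intertwiner I2 I1 N2 r2).
Hypothesis r1K : exists M, forall x, lev I1 M x -> cong I1 (r2 (r1 x)) x.
Hypothesis r2K : exists M, forall x, lev I2 M x -> cong I2 (r1 (r2 x)) x.

Lemma lev_mfull d (I : Pol d -> Prop) N : is_ideal I -> lev I N (mono (mfull d N)).
Proof. by move=> idI; rewrite -[mono _]mulr1; apply: (lev_mono idI). Qed.

(** Take for x the value of [r2] at a high power of u: it is small by continuity, and [r1] returns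
    the power. A monomial value makes [var_independent] applicable. *)
Lemma hits_monomial M : exists x (K : 'X_{1..d2}),
  lev I1 M x /\ cong I2 (r1 x) (mono K).
Proof.
have [M' HM'] := li_cont r2P M; have [M'' HM''] := r2K.
exists (r2 (mono (mfull d2 (maxn M' M'')))), (mfull d2 (maxn M' M'')).
have l := lev_mfull (maxn M' M'') idI2.
by split; [apply: HM'; apply: lev_le l; apply: leq_maxl
          |apply: HM''; apply: lev_le l; apply: leq_maxr].
Qed.

Lemma exponent_uniq (A B : 'X_{1..d2}) M :
  (forall x, lev I1 M x -> cong I2 (mono A * r1 x) (mono B * r1 x)) -> A = B.
Proof.
move=> AB; have [x [K [lx xK]]] := hits_monomial M.
suff /(mono_inj idI2 indI2) e : cong I2 (mono (A + K)%MM) (mono (B + K)%MM).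
  apply/mnmP => j; move/mnmP: e => /(_ j).
  by rewrite !mnmDE => /eqP; rewrite eqn_add2r => /eqP.
rewrite !monoD; apply: (cong_trans idI2 (congM idI2 (mono A) (cong_sym idI2 xK))).
by apply: (cong_trans idI2 (AB x lx)); apply: (congM idI2).
Qed.

(* Iterating the intertwining relation shows that u^(kp) u^K is divisible by
   u^(kq) for all k, so q <= p. *)
Lemma exponent_exists (n : 'X_{1..d1}) : exists (t : 'X_{1..d2}) M, (N1 <= M)%N /\
  forall x, lev I1 M x -> cong I2 (r1 (mono n * x)) (mono t * r1 x).
Proof.
have [p [q [M [NM pq]]]] := li_equiv r1P n.
have [x0 [K [lx xK]]] := hits_monomial M.
have pqk k : exists z, cong I2 (mono p ^+ k * r1 x0) (mono q ^+ k * z).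
  exists (r1 (mono (n *+ k)%MM * x0)).
  elim: k => [|k IH].
    by rewrite mulm0n mono0 !expr0 !mul1r; apply: (cong_refl idI2).
  rewrite exprS -mulrA; apply: (cong_trans idI2 (congM idI2 (mono p) IH)).
  rewrite mulrCA [mono q ^+ k.+1]exprSr -mulrA; apply: (congM idI2).
  by rewrite mulmS monoD -mulrA; apply: pq; apply: (levM idI1).
have qp j : (q j <= p j)%N.
  (* With k = K_j + 1 the inequality k q_j <= k p_j + K_j forces q_j <= p_j. *)
  have [z kz] := pqk (K j).+1.
  have : (q j * (K j).+1 <= (q *+ (K j).+1)%MM j)%N by rewrite mulmnE mulnC.
  move=> /mono_factorX [z' qz].
  have : cong I2 (mono (p *+ (K j).+1 + K)%MM) ('X_j ^+ (q j * (K j).+1) * (z' * z)).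
    rewrite mulrA -qz monoD !monoMn; apply: (cong_trans idI2) kz.
    by apply: (congM idI2); apply: (cong_sym idI2).
  by move=> /indI2; rewrite mnmDE mulmnE; nia.
exists (p - q)%MM, M; split=> // x lM; have := pq x lM.
have {1}-> : p = (q + (p - q))%MM.
  by apply/mnmP => i; rewrite mnmDE mnmBE subnKC.
rewrite monoD -mulrA => h; apply: (cong_sym idI2); apply: (regI2 (n := q)).
by rewrite mulrBr.
Qed.

Lemma exponent_sig n : {t : 'X_{1..d2} | exists M, (N1 <= M)%N /\
  forall x, lev I1 M x -> cong I2 (r1 (mono n * x)) (mono t * r1 x)}.
Proof. by apply: constructive_indefinite_description; apply: exponent_exists. Qed.

Definition expo n := sval (exponent_sig n).

Lemma expoP n : exists M, (N1 <= M)%N /\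
  forall x, lev I1 M x -> cong I2 (r1 (mono n * x)) (mono (expo n) * r1 x).
Proof. exact: (svalP (exponent_sig n)). Qed.

Lemma expoD m n : expo (m + n)%MM = (expo m + expo n)%MM.
Proof.
have [M1 [_ H1]] := expoP m; have [M2 [_ H2]] := expoP n.
have [M3 [_ H3]] := expoP (m + n)%MM.
apply: (@exponent_uniq _ _ (maxn M1 (maxn M2 M3))) => x lx.
have l1 : lev I1 M1 x by apply: lev_le lx; lia.
have l2 : lev I1 M2 x by apply: lev_le lx; lia.
have l3 : lev I1 M3 x by apply: lev_le lx; lia.
apply: (cong_trans idI2 (cong_sym idI2 (H3 _ l3))).
rewrite !monoD -!mulrA; apply: (cong_trans idI2 (H1 _ (levM idI1 _ l1))).
by apply: (congM idI2); apply: H2.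
Qed.

Lemma expo0 : expo 0%MM = 0%MM.
Proof.
have := expoD 0%MM 0%MM; rewrite addm0 => e.
apply/mnmP => j; move/mnmP: e => /(_ j); rewrite mnmDE mnm0E; lia.
Qed.

Lemma li_0 : I2 (r1 0).
Proof.
have := li_add r1P (lev0 idI1 N1) (lev0 idI1 N1); rewrite addr0 => h.
by apply: ideal_eq (idealN idI2 h); ring.
Qed.

Lemma li_N x : lev I1 N1 x -> cong I2 (r1 (- x)) (- r1 x).
Proof.
move=> lx; have := li_add r1P lx (levN idI1 lx); rewrite subrr => h.
by apply: ideal_eq (idealB idI2 li_0 h); ring.
Qed.

Lemma li_Mn x k : lev I1 N1 x -> cong I2 (r1 (x *+ k)) (r1 x *+ k).
Proof.
move=> lx; elim: k => [|k IH].
  by rewrite !mulr0n; apply/(cong0 I2); apply: li_0.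
rewrite !mulrS; apply: (cong_trans idI2 (li_add r1P lx _)).
  by rewrite -mulr_natl; apply: (levM idI1).
by apply: (congD idI2) IH; apply: (cong_refl idI2).
Qed.

Lemma li_Z (c : int) x : lev I1 N1 x -> cong I2 (r1 (c *: x)) (c *: r1 x).
Proof.
move=> lx; case: c => k; first by rewrite -natz !scaler_nat; apply: li_Mn.
rewrite NegzE !scaleNr -natz !scaler_nat.
apply: (cong_trans idI2 (li_N _)); last by apply: (congN idI2); apply: li_Mn.
by rewrite -mulr_natl; apply: (levM idI1).
Qed.

(** The ring homomorphism given by the exponents alone. It becomes the isomorphism of actions in
    place of [r1], which is controlled only on small elements. *)
Definition varmap (f : Pol d1) : Pol d2 :=
  f \mPo [tuple mono (expo U_(i)%MM) | i < d1].

Lemma varmapD f g : varmap (f + g) = varmap f + varmap g.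
Proof. exact: comp_mpolyD. Qed.

Lemma varmapB f g : varmap (f - g) = varmap f - varmap g.
Proof. exact: comp_mpolyB. Qed.

Lemma varmapM f g : varmap (f * g) = varmap f * varmap g.
Proof. exact: rmorphM. Qed.

Lemma varmapZ (c : int) f : varmap (c *: f) = c *: varmap f.
Proof. exact: comp_mpolyZ. Qed.

Lemma varmap_mono n : varmap (mono n) = mono (expo n).
Proof.
rewrite /varmap comp_mpolyX.
pose G m : Pol d2 := mono (expo m).
have GD : {morph G : x y / (x + y)%MM >-> x * y}.
  by move=> x y; rewrite /G expoD monoD.
have G0 : G 0%MM = 1 by rewrite /G expo0 mono0.
rewrite -/(G n) [n in RHS]multinomUE_id (big_morph G GD G0).
apply: eq_bigr => i _; rewrite tnth_mktuple -/(G _).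
elim: (n i) => [|k IH]; first by rewrite mulm0n G0.
by rewrite exprS IH mulmS GD.
Qed.

Lemma li_varmap f : exists M, (N1 <= M)%N /\
  forall x, lev I1 M x -> cong I2 (r1 (f * x)) (varmap f * r1 x).
Proof.
elim/mpolyind: f => [|c m f _ _ [M [NM HM]]].
  exists N1; split=> // x _; rewrite mul0r /varmap comp_mpoly0 mul0r.
  by apply/(cong0 I2); apply: li_0.
have [M' [NM' HM']] := expoP m.
exists (maxn M M'); split; first lia.
move=> x lx; have l1 : lev I1 M x by apply: lev_le lx; lia.
have l2 : lev I1 M' x by apply: lev_le lx; lia.
have l3 : lev I1 N1 x by apply: lev_le l1.
rewrite mulrDl varmapD mulrDl; apply: (cong_trans idI2 (li_add r1P _ _)).
- by apply: (levM idI1).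
- by apply: (levM idI1).
apply: (congD idI2); last exact: HM.
rewrite -/(mono m) varmapZ varmap_mono -!scalerAl.
apply: (cong_trans idI2 (li_Z _ _)); first exact: (levM idI1).
by rewrite /cong -scalerBr; apply: (idealZ idI2); apply: HM'.
Qed.

(** For large K, [r1] sends f u^K to [varmap f] times the image of u^K, which is 0 modulo I2. As
    [r2] inverts [r1] on small elements, f u^K lies in I1, and u^K cancels. *)
Lemma varmap_ideal f : I2 (varmap f) -> I1 f.
Proof.
move=> If; have [M [NM HM]] := li_varmap f; have [M' HM'] := r1K.
have [M'' HM''] := li_cont r1P N2.
pose K := maxn M (maxn M' M''); apply: (regI1 (n := mfull d1 K)).
have lx : lev I1 K (f * mono (mfull d1 K)).
  by apply: (levM idI1); apply: lev_mfull.
have I0 : cong I2 (r1 (f * mono (mfull d1 K))) (r1 0).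
  have lM : lev I1 M (mono (mfull d1 K)).
    by apply: lev_le (lev_mfull K idI1); rewrite /K; lia.
  apply: (cong_trans idI2 (HM _ lM)).
  apply: (idealB idI2 _ li_0); rewrite mulrC; exact: (idealM idI2).
have l2 : lev I2 N2 (r1 (f * mono (mfull d1 K))).
  by apply: HM''; apply: lev_le lx; rewrite /K; lia.
rewrite mulrC; apply/(cong0 I1); apply: (cong_trans idI1) (HM' 0 (lev0 idI1 _)).
apply: (cong_trans idI1) (li_cong r2P l2 I0).
by apply: (cong_sym idI1); apply: HM'; apply: lev_le lx; rewrite /K; lia.
Qed.

End Intertwiners.

Section Rigidity.

Variables (d1 d2 : nat) (I1 : Pol d1 -> Prop) (I2 : Pol d2 -> Prop).
Hypotheses (idI1 : is_ideal I1) (idI2 : is_ideal I2).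
Hypotheses (regI1 : u_regular I1) (regI2 : u_regular I2).
Hypotheses (indI1 : var_independent I1) (indI2 : var_independent I2).
Variables (N1 N2 : nat) (r1 : Pol d1 -> Pol d2) (r2 : Pol d2 -> Pol d1).
Hypotheses (r1P : local_intertwiner I1 I2 N1 r1).
Hypotheses (r2P : local_intertwiner I2 I1 N2 r2).
Hypothesis r1K : exists M, forall x, lev I1 M x -> cong I1 (r2 (r1 x)) x.
Hypothesis r2K : exists M, forall x, lev I2 M x -> cong I2 (r1 (r2 x)) x.

(** Applying [r1] and then [r2] to u^n x, for x a high power of u, compares the two exponents in R;
    then x is cancelled. *)
Lemma expoK n :
  expo idI2 idI1 regI1 indI1 r2P r1P r1K (expo idI1 idI2 regI2 indI2 r1P r2P r2K n)
  = n.
Proof.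
set t := expo idI1 idI2 regI2 indI2 r1P r2P r2K n.
set t' := expo _ _ _ _ _ _ _ t.
have [M1 [_ H1]] := expoP idI1 idI2 regI2 indI2 r1P r2P r2K n.
have [M2 [_ H2]] := expoP idI2 idI1 regI1 indI1 r2P r1P r1K t.
have [M3 H3] := r1K; have [M4 H4] := li_cont r1P (maxn N2 M2).
pose K := maxn (maxn M1 M3) M4; have lK := lev_mfull K idI1.
set x := mono (mfull d1 K) in lK.
have lx M : (M <= K)%N -> lev I1 M x by move=> MK; apply: lev_le lK.
have [l1 l3 l4] : [/\ lev I1 M1 x, lev I1 M3 x & lev I1 M4 x].
  by split; apply: lx; rewrite /K; lia.
have e : cong I1 (mono n * x) (mono t' * x).
  apply: (cong_trans idI1 (cong_sym idI1 (H3 _ (levM idI1 _ l3)))).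
  apply: (cong_trans idI1 (li_cong r2P _ (H1 _ l1))).
    by apply: (lev_le (leq_maxl N2 M2)); apply: H4; apply: (levM idI1).
  apply: (cong_trans idI1 (H2 _ _)); last by apply: (congM idI1); apply: H3.
  by apply: (lev_le (leq_maxr N2 M2)); apply: H4.
apply/esym/(mono_inj idI1 indI1); apply: (regI1 (n := mfull d1 K)).
by move: e; rewrite /cong; apply: ideal_eq; rewrite -/x; ring.
Qed.

Lemma varmapK f :
  varmap idI2 idI1 regI1 indI1 r2P r1P r1K
    (varmap idI1 idI2 regI2 indI2 r1P r2P r2K f) = f.
Proof.
elim/mpolyind: f => [|c m f _ _ IH]; first by rewrite /varmap !comp_mpoly0.
rewrite !varmapD IH !varmapZ; congr (_ *: _ + _).
by rewrite -/(mono m) !varmap_mono expoK.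
Qed.

End Rigidity.

Lemma intertwiners_alg_act_iso d1 d2 (I1 : Pol d1 -> Prop) (I2 : Pol d2 -> Prop)
    N1 N2 (r1 : Pol d1 -> Pol d2) (r2 : Pol d2 -> Pol d1) :
  is_ideal I1 -> is_ideal I2 -> u_regular I1 -> u_regular I2 ->
  var_independent I1 -> var_independent I2 ->
  local_intertwiner I1 I2 N1 r1 -> local_intertwiner I2 I1 N2 r2 ->
  (exists M, forall x, lev I1 M x -> cong I1 (r2 (r1 x)) x) ->
  (exists M, forall x, lev I2 M x -> cong I2 (r1 (r2 x)) x) ->
  alg_act_iso I1 I2.
Proof.
move=> idI1 idI2 reg1 reg2 ind1 ind2 r1P r2P r1K r2K.
pose b := varmap idI1 idI2 reg2 ind2 r1P r2P r2K.
pose b' := varmap idI2 idI1 reg1 ind1 r2P r1P r1K.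
exists (expo idI1 idI2 reg2 ind2 r1P r2P r2K), b; split.
- by exists (expo idI2 idI1 reg1 ind1 r2P r1P r1K) => n; rewrite expoK.
- exact: expoD.
split.
- move=> x y; rewrite /cong -varmapB; split=> [Ixy|].
    (* This inclusion is [varmap_ideal] for the inverse pair of intertwiners. *)
    apply: (@varmap_ideal _ _ _ _ idI2 idI1 reg2 reg1 ind1 _ _ _ _ r2P r1P r2K r1K).
    by rewrite varmapK.
  by apply: varmap_ideal.
- move=> y; exists (b' y); rewrite /b /b' varmapK; exact: (cong_refl idI2).
- by move=> x y; rewrite /b varmapD; apply: (cong_refl idI2).
- by move=> n x; rewrite /b varmapM varmap_mono; apply: (cong_refl idI2).
Qed.

(** * Transport along an isomorphism of actions *)

(** An isomorphism of actions with chosen inverses on representatives, so that [act_iso_sym] can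
    exchange the two sides. *)
Record act_iso d1 d2 (I1 : Pol d1 -> Prop) (I2 : Pol d2 -> Prop)
    (t : 'X_{1..d1} -> 'X_{1..d2}) (t' : 'X_{1..d2} -> 'X_{1..d1})
    (b : Pol d1 -> Pol d2) (b' : Pol d2 -> Pol d1) : Prop := ActIso {
  ai_tK : cancel t t';
  ai_tVK : cancel t' t;
  ai_tD : forall m n, t (m + n)%MM = (t m + t n)%MM;
  ai_cong : forall x y, cong I1 x y -> cong I2 (b x) (b y);
  ai_congV : forall x y, cong I2 x y -> cong I1 (b' x) (b' y);
  ai_K : forall x, cong I1 (b' (b x)) x;
  ai_VK : forall y, cong I2 (b (b' y)) y;
  ai_add : forall x y, cong I2 (b (x + y)) (b x + b y);
  ai_mono : forall n x, cong I2 (b (mono n * x)) (mono (t n) * b x)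
}.

Lemma act_iso_sym d1 d2 (I1 : Pol d1 -> Prop) (I2 : Pol d2 -> Prop) t t' b b' :
  is_ideal I1 -> is_ideal I2 ->
  act_iso I1 I2 t t' b b' -> act_iso I2 I1 t' t b' b.
Proof.
move=> id1 id2 A; split=> //.
- exact: (ai_tVK A).
- exact: (ai_tK A).
- move=> m n; rewrite -{1}(ai_tVK A m) -{1}(ai_tVK A n) -(ai_tD A).
  exact: (ai_tK A).
- exact: (ai_congV A).
- exact: (ai_cong A).
- exact: (ai_VK A).
- exact: (ai_K A).
- move=> x y; apply: (cong_trans id1 _ (ai_K A _)); apply: (ai_congV A).
  apply: (cong_sym id2); apply: (cong_trans id2 (ai_add A _ _)).
  by apply: (congD id2); apply: (ai_VK A).
- move=> n x; apply: (cong_trans id1 _ (ai_K A _)); apply: (ai_congV A).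
  apply: (cong_sym id2); apply: (cong_trans id2 (ai_mono A _ _)).
  by rewrite (ai_tVK A); apply: (congM id2); apply: (ai_VK A).
Qed.

Lemma alg_act_iso_act_iso d1 d2 (I1 : Pol d1 -> Prop) (I2 : Pol d2 -> Prop) :
  is_ideal I1 -> is_ideal I2 -> alg_act_iso I1 I2 ->
  exists t t' b b', act_iso I1 I2 t t' b b'.
Proof.
move=> id1 id2 [t [b [[t' tK tVK] tD [bc bs bD bm]]]].
pose b' y := sval (constructive_indefinite_description _ (bs y)).
have bK y : cong I2 (b (b' y)) y.
  exact: (svalP (constructive_indefinite_description _ (bs y))).
exists t, t', b, b'; split=> //.
- by move=> x y /bc.
- move=> x y xy; apply/bc; apply: (cong_trans id2 (bK x)).
  by apply: (cong_trans id2 xy); apply: (cong_sym id2).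
- by move=> x; apply/bc.
Qed.

(** Two ways of writing an integer vector as a difference of exponents are compared by a sum in N^d,
    to which a monoid map such as t can be applied. *)
Lemma zsplit_pos_neg d (a c : 'X_{1..d}) (n : 'I_d -> int) :
  (forall i, n i = Posz (a i) - Posz (c i)) ->
  (zneg n + a = c + zpos n)%MM.
Proof.
move=> nE; apply/mnmP => i; rewrite !mnmDE !mnmE; have := nE i.
by case: (n i) => k; rewrite ?NegzE; lia.
Qed.

Lemma zpos_neg d (n : 'I_d -> int) i : n i = Posz (zpos n i) - Posz (zneg n i).
Proof. by rewrite !mnmE; case: (n i) => k; rewrite ?NegzE; lia. Qed.

Section Transport.

Variables (d1 d2 : nat) (I1 : Pol d1 -> Prop) (I2 : Pol d2 -> Prop).
Hypotheses (idI1 : is_ideal I1) (idI2 : is_ideal I2).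
Variables (t : 'X_{1..d1} -> 'X_{1..d2}) (t' : 'X_{1..d2} -> 'X_{1..d1}).
Variables (b : Pol d1 -> Pol d2) (b' : Pol d2 -> Pol d1).
Hypothesis A : act_iso I1 I2 t t' b b'.

Let A' := act_iso_sym idI1 idI2 A.

Lemma ai_sub x y : cong I2 (b (x - y)) (b x - b y).
Proof.
have := ai_add A (x - y) y; rewrite subrK => /(cong_sym idI2) h.
by apply: cong_eq h; ring.
Qed.

Lemma constructible_sat d (I : Pol d -> Prop) C x y : is_ideal I ->
  constructible I C -> cong I x y -> C x <-> C y.
Proof.
move=> idI cC xy; have [_ _ Cs] := constructible_subgroup idI cC.
by split; apply: Cs => //; apply: (cong_sym idI).
Qed.

Definition pull (D : Pol d2 -> Prop) : Pol d1 -> Prop := fun x => D (b x).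

Lemma constructible_pull D : constructible I2 D -> constructible I1 (pull D).
Proof.
elim=> [|m {}D cD IH|m {}D cD IH]; first exact: cons_top.
  suff -> : pull (fun x => exists c, D c /\ cong I2 x (mono m * c))
      = (fun x => exists c, pull D c /\ cong I1 x (mono (t' m) * c)).
    exact: cons_img.
  apply: functional_extensionality => x; apply: propositional_extensionality.
  split=> [[c [Dc xc]]|[c [Dc xc]]].
    exists (b' c); split.
      by apply/(constructible_sat idI2 cD (ai_VK A c)).
    apply: (cong_trans idI1 (cong_sym idI1 (ai_K A x))).
    exact: (cong_trans idI1 (ai_congV A xc) (ai_mono A' _ _)).
  exists (b c); split=> //; apply: (cong_trans idI2 (ai_cong A xc)).
  by have := ai_mono A (t' m) c; rewrite (ai_tVK A).
suff -> : pull (fun x => D (mono m * x)) = (fun x => pull D (mono (t' m) * x)).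
  exact: cons_pre.
apply: functional_extensionality => x; apply: propositional_extensionality.
apply: (constructible_sat idI2 cD); apply: (cong_sym idI2).
by have := ai_mono A (t' m) x; rewrite (ai_tVK A).
Qed.

Lemma pull_diff D x y :
  constructible I2 D -> D (b (b' y - x)) <-> D (y - b x).
Proof.
move=> cD; apply: (constructible_sat idI2 cD).
apply: (cong_trans idI2 (ai_sub _ _)); apply: (congD idI2).
  exact: (ai_VK A).
exact: (cong_refl idI2).
Qed.

(** The conjunct on D empties the point at sets that are not constructible, since [pull D] may be
    constructible when D is not saturated modulo I2. *)
Lemma push_proof (w : Om I1) :
  is_Om_point I2 (fun D y => constructible I2 D /\ sval w (pull D) (b' y)).
Proof.
have [w1 w2 _] := svalP w; split=> [D cD|D E cD cE DE y [_ wy]|D nD y []//].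
  have [x xw] := w1 _ (constructible_pull cD); exists (b x) => y.
  have yx := pull_diff x y cD.
  by split=> [[_ /xw /yx]|/yx Dy] //; split=> //; apply/xw.
split=> //; apply: (w2 (pull D)) wy; [exact: constructible_pull..|].
by move=> z; apply: DE.
Qed.

Definition push (w : Om I1) : Om I2 := exist _ _ (push_proof w).

Lemma push_iota x : push (Defs.iota I1 x) = Defs.iota I2 (b x).
Proof.
apply: sval_inj; apply: functional_extensionality => D.
apply: functional_extensionality => y; apply: propositional_extensionality => /=.
have yx := @pull_diff D x y.
split=> [[cD [_ /(yx cD)]]|[cD /(yx cD) Dy]] //; split=> //; split=> //.
exact: constructible_pull.
Qed.

Lemma push_agree Cs w w' :
  agree (List.map pull Cs) w w' -> agree Cs (push w) (push w').
Proof.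
move=> ag D inD y; have e := ag _ (List.in_map pull _ _ inD) (b' y).
by split=> [[cD /e]|[cD /e]].
Qed.

Definition lmap (v : LCl I1) : LCl I2 :=
  lclass I2 (t (lrep v).1, b (lrep v).2).

Definition zmap (n : 'I_d1 -> int) : 'I_d2 -> int :=
  fun i => Posz (t (zpos n) i) - Posz (t (zneg n) i).

Definition gmap (g : Grp I1) : Grp I2 := (lmap g.1, zmap g.2).

Lemma t0 : t 0%MM = 0%MM.
Proof.
have := ai_tD A 0%MM 0%MM; rewrite addm0 => e.
apply/mnmP => j; move/mnmP: e => /(_ j); rewrite mnmDE mnm0E; lia.
Qed.

Lemma lmap_class r : lmap (lclass I1 r) = lclass I2 (t r.1, b r.2).
Proof.
have [k Ik] := lrep_class idI1 r; rewrite /lmap; set s := lrep _ in Ik *.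
apply: (lclass_eq idI2); exists (t k) => /=.
have : cong I1 (mono (k + r.1)%MM * s.2) (mono (k + s.1)%MM * r.2).
  by apply: ideal_eq Ik; rewrite !monoD; ring.
move=> /(ai_cong A) h.
have {}h := cong_trans idI2 (cong_sym idI2 (ai_mono A _ _))
  (cong_trans idI2 h (ai_mono A _ _)).
by move: h; rewrite /cong; apply: ideal_eq; rewrite !(ai_tD A) !monoD; ring.
Qed.

Lemma lmap_emb x : lmap (emb I1 x) = emb I2 (b x).
Proof. by rewrite /emb lmap_class /= t0. Qed.

Lemma lmap_add v w : lmap (ladd v w) = ladd (lmap v) (lmap w).
Proof.
rewrite -[v in LHS](lrepK v) -[w in LHS](lrepK w) ladd_class // lmap_class.
rewrite [RHS]ladd_class //; apply: (lclass_eq idI2); exists 0%MM => /=.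
rewrite mono0 mul1r (ai_tD A) -mulrBr; apply: (idealM idI2).
apply: (cong_trans idI2 (ai_add A _ _)).
by apply: (congD idI2); apply: (ai_mono A).
Qed.

Lemma lmap_mono n v : lmap (lmono n v) = lmono (zmap n) (lmap v).
Proof.
rewrite -[v in LHS](lrepK v) lmono_class // lmap_class [RHS]lmono_class //.
apply: (lclass_eq idI2); exists 0%MM => /=; rewrite mono0 mul1r.
have := idealM idI2 (mono (t (lrep v).1 + zneg (zmap n))%MM)
  (ai_mono A (zpos n) (lrep v).2).
apply: ideal_eq; rewrite mulrBr; congr (_ - _).
rewrite !mulrA -!monoD (ai_tD A) -!addmA; congr (mono (_ + _)%MM * _).
exact: zsplit_pos_neg.
Qed.

Lemma zmapD m n : zmap (fun i => m i + n i) = (fun i => zmap m i + zmap n i).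
Proof.
apply: functional_extensionality => i; rewrite /zmap.
set mn := fun i => m i + n i.
have e : (zneg mn + (zpos m + zpos n) = zneg m + zneg n + zpos mn)%MM.
  apply: zsplit_pos_neg => j; rewrite !mnmDE /mn (zpos_neg m) (zpos_neg n); lia.
move/(f_equal t)/mnmP: e => /(_ i); rewrite !(ai_tD A) !mnmDE; lia.
Qed.

Lemma gmap_mul g h : gmap (gmul g h) = gmul (gmap g) (gmap h).
Proof. by rewrite /gmap /gmul /= lmap_add lmap_mono zmapD. Qed.

Lemma lmap_gact g v : lmap (gact g v) = gact (gmap g) (lmap v).
Proof. by rewrite /gact lmap_add lmap_mono. Qed.

Variables (Dom1 : Grp I1 -> Om I1 -> Prop) (th1 : Grp I1 -> Om I1 -> Om I1).
Variables (Dom2 : Grp I2 -> Om I2 -> Prop) (th2 : Grp I2 -> Om I2 -> Om I2).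
Hypotheses (ext1 : is_Om_ext Dom1 th1) (ext2 : is_Om_ext Dom2 th2).

Definition arrow_map (a : Grp I1 * Om I1) : Grp I2 * Om I2 :=
  (gmap a.1, push a.2).

Lemma gmap_gact g x y : gact g (emb I1 x) = emb I1 y ->
  gact (gmap g) (emb I2 (b x)) = emb I2 (b y).
Proof. by move=> /(f_equal lmap); rewrite lmap_gact !lmap_emb. Qed.

Lemma push_Dom g w : Dom1 g w -> Dom2 (gmap g) (push w).
Proof.
move=> gw; case: ext2 => DomP _ _; apply/DomP => Cs.
have [x [y [ag gxy _]]] := Dom_approx ext1 (List.map pull Cs) [::] gw.
exists (Defs.iota I2 (b x)); split; last by rewrite -push_iota; apply: push_agree.
by exists (b x), (b y); rewrite (gmap_gact gxy).
Qed.

(** Approximate w by a point x of R that g sends to y in R. By continuity both sides are then close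
    to the image of y under b, at every level. *)
Lemma push_th g w : Dom1 g w -> push (th1 g w) = th2 (gmap g) (push w).
Proof.
move=> gw; have Dw := push_Dom gw; apply: (Om_ext idI2) => N.
case: (ext2) => DomP thP [_ _ _ topo].
have [_ /(_ _ Dw [:: lev I2 N]) [Cs HCs]] := topo (gmap g).
have [x [y [ag gxy agy]]] :=
  Dom_approx ext1 (List.map pull Cs) (List.map pull [:: lev I2 N]) gw.
exists (b y); split; apply: agree_iota_near => //.
  by rewrite -push_iota; apply: push_agree.
rewrite -(thP _ _ _ (gmap_gact gxy)); apply: HCs.
  apply/DomP => Ds; exists (Defs.iota I2 (b x)); split=> //.
  by exists (b x), (b y); rewrite (gmap_gact gxy).
by rewrite -push_iota; apply: push_agree.
Qed.

Lemma arrow_map_morph : gpd_morph Dom1 th1 Dom2 th2 arrow_map.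
Proof.
split=> [[g w]|g h w gw hw|g w gw Cs]; first exact: push_Dom.
  by rewrite /arrow_map /= push_th // gmap_mul.
exists (List.map pull Cs) => w' gw' ag; split=> //; exact: push_agree.
Qed.

End Transport.

Section TransportK.

Variables (d1 d2 : nat) (I1 : Pol d1 -> Prop) (I2 : Pol d2 -> Prop).
Hypotheses (idI1 : is_ideal I1) (idI2 : is_ideal I2).
Variables (t : 'X_{1..d1} -> 'X_{1..d2}) (t' : 'X_{1..d2} -> 'X_{1..d1}).
Variables (b : Pol d1 -> Pol d2) (b' : Pol d2 -> Pol d1).
Hypotheses (A : act_iso I1 I2 t t' b b') (A' : act_iso I2 I1 t' t b' b).

Lemma pushK w : push idI2 idI1 A' (push idI1 idI2 A w) = w.
Proof.
apply: sval_inj; apply: functional_extensionality => C.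
apply: functional_extensionality => x; apply: propositional_extensionality => /=.
case: (classic (constructible I1 C)) => [cC|nC]; last first.
  by have [_ _ /(_ _ nC x) nw] := svalP w; split=> [[]|/nw].
(* Constructible sets are saturated modulo the ideal, so this is an equality of sets although b'
   inverts b only up to congruence. *)
have -> : pull b (pull b' C) = C.
  apply: functional_extensionality => z; apply: propositional_extensionality.
  by apply: (constructible_sat idI1 cC); apply: (ai_K A).
have wx : sval w C (b' (b x)) <-> sval w C x.
  have := ai_K A x; have [C0 _ _] := constructible_subgroup idI1 cC.
  move=> xx; split=> [wx|wx]; apply/(Om_coset idI1 _ cC wx).
    by apply/(constructible_sat (y := 0) idI1 cC) => //;
      apply/(cong0 I1); apply: (cong_sym idI1).
  by apply/(constructible_sat (y := 0) idI1 cC) => //; apply/(cong0 I1).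
split=> [[_ [_ /wx]]|/wx] // h; split=> //; split=> //.
exact: (constructible_pull idI2 idI1 A').
Qed.

Lemma lmapK (v : LCl I1) : lmap I1 t' b' (lmap I2 t b v) = v.
Proof.
rewrite -[v in RHS](lrepK v) (lmap_class idI2 idI1 A') /= (ai_tK A).
apply: (lclass_eq idI1); exists 0%MM => /=; rewrite mono0 mul1r -mulrBr.
by apply: (idealM idI1); apply: (ai_K A).
Qed.

Lemma zmapK n : zmap t' (zmap t n) = n.
Proof.
apply: functional_extensionality => i; rewrite {1}/zmap.
have e : (zneg (zmap t n) + t (zpos n) = t (zneg n) + zpos (zmap t n))%MM.
  exact: zsplit_pos_neg.
move/(f_equal t')/mnmP: e => /(_ i); rewrite !(ai_tD A') !(ai_tK A) !mnmDE.
have := zpos_neg n i; lia.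
Qed.

Lemma arrow_mapK a : arrow_map idI2 idI1 A' (arrow_map idI1 idI2 A a) = a.
Proof.
by case: a => [[v n] w]; rewrite /arrow_map /gmap /= pushK lmapK zmapK.
Qed.

End TransportK.

(** * The two implications *)

Lemma alg_act_iso_gpd_iso d1 d2 (I1 : Pol d1 -> Prop) (I2 : Pol d2 -> Prop)
    Dom1 th1 Dom2 th2 :
  is_ideal I1 -> is_ideal I2 -> @is_Om_ext d1 I1 Dom1 th1 ->
  @is_Om_ext d2 I2 Dom2 th2 -> alg_act_iso I1 I2 ->
  gpd_iso Dom1 th1 Dom2 th2.
Proof.
move=> id1 id2 ext1 ext2 /(alg_act_iso_act_iso id1 id2) [t [t' [b [b' A]]]].
pose A' := act_iso_sym id1 id2 A.
exists (arrow_map id1 id2 A), (arrow_map id2 id1 A'); split.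
- exact: arrow_map_morph.
- exact: arrow_map_morph.
- by move=> a _; rewrite arrow_mapK.
- by move=> a _; rewrite arrow_mapK.
Qed.

Lemma gpd_iso_alg_act_iso d1 d2 (I1 : Pol d1 -> Prop) (I2 : Pol d2 -> Prop)
    Dom1 th1 Dom2 th2 :
  (0 < d1)%N -> (0 < d2)%N -> is_ideal I1 -> is_ideal I2 ->
  cond_b I1 -> cond_d I1 -> cond_b I2 -> cond_d I2 ->
  @is_Om_ext d1 I1 Dom1 th1 -> @is_Om_ext d2 I2 Dom2 th2 ->
  gpd_iso Dom1 th1 Dom2 th2 -> alg_act_iso I1 I2.
Proof.
move=> d1p d2p id1 id2 b1 c1 b2 c2 ext1 ext2 [phi [psi [phiM psiM phiK psiK]]].
have reg1 := cond_u_regular id1 d1p b1 c1.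
have reg2 := cond_u_regular id2 d2p b2 c2.
have ind1 := cond_var_independent id1 b1 c1.
have ind2 := cond_var_independent id2 b2 c2.
(* The base points correspond under the homeomorphism, so that the two intertwiners are mutually
   inverse on small elements. *)
pose w1 := Defs.iota I1 0; pose w2 := ubase phi w1.
have [N1 unif1] := coc_tau_uniform id1 ext1 phiM d1p b1 c1 reg1.
have [N2 unif2] := coc_tau_uniform id2 ext2 psiM d2p b2 c2 reg2.
have [r1 [r1P r1E]] := local_intertwiner_exists id1 id2 ext1 ext2 phiM psiM
  phiK psiK d1p b1 c1 reg1 reg2 ind2 w1 unif1.
have [r2 [r2P r2E]] := local_intertwiner_exists id2 id1 ext2 ext1 psiM phiM
  psiK phiK d2p b2 c2 reg2 reg1 ind1 w2 unif2.
have w2K : ubase psi w2 = w1 := ubaseK id1 id2 ext1 ext2 phiM psiM phiK w1.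
apply: (intertwiners_alg_act_iso id1 id2 reg1 reg2 ind1 ind2 r1P r2P).
- have [M HM] := li_cont r1P N2; exists (maxn N1 M) => x lx.
  have l1 : lev I1 N1 x by apply: lev_le lx; apply: leq_maxl.
  have l2 : lev I1 M x by apply: lev_le lx; apply: leq_maxr.
  (* The arrow (tau x, [w1]) goes to (tau (r1 x), [w2]) and returns as (tau (r2 (r1 x)), [w1]). *)
  have := phiK (tau I1 x, w1) (Dom_gi id1 ext1 x 0%MM w1).
  rewrite (r1E _ l1) (r2E _ (HM _ l2)) => /(f_equal fst).
  exact: (tau_inj id1 reg1).
- have [M HM] := li_cont r2P N1; exists (maxn N2 M) => x lx.
  have l1 : lev I2 N2 x by apply: lev_le lx; apply: leq_maxl.
  have l2 : lev I2 M x by apply: lev_le lx; apply: leq_maxr.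
  have := psiK (tau I2 x, w2) (Dom_gi id2 ext2 x 0%MM w2).
  rewrite (r2E _ l1) w2K (r1E _ (HM _ l2)) => /(f_equal fst).
  exact: (tau_inj id2 reg2).
Qed.

Theorem theorem5p13 (d1 d2 : nat) (I1 : Pol d1 -> Prop) (I2 : Pol d2 -> Prop) :
  (0 < d1)%N -> (0 < d2)%N ->
  is_ideal I1 -> is_ideal I2 ->
  nonzero_ideal I1 -> nonzero_ideal I2 ->
  cond_a I1 -> cond_b I1 -> cond_c I1 -> cond_d I1 ->
  cond_a I2 -> cond_b I2 -> cond_c I2 -> cond_d I2 ->
  forall (Dom1 : Grp I1 -> Om I1 -> Prop) (th1 : Grp I1 -> Om I1 -> Om I1)
         (Dom2 : Grp I2 -> Om I2 -> Prop) (th2 : Grp I2 -> Om I2 -> Om I2),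
  is_Om_ext Dom1 th1 -> is_Om_ext Dom2 th2 ->
  (alg_act_iso I1 I2 <-> @gpd_iso d1 d2 I1 I2 Dom1 th1 Dom2 th2).
Proof.
move=> d1p d2p id1 id2 _ _ _ b1 _ c1 _ b2 _ c2 Dom1 th1 Dom2 th2 ext1 ext2.
split; first exact: alg_act_iso_gpd_iso.
exact: gpd_iso_alg_act_iso.
Qed.
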